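(* Let $G$ be a finite abelian group and $F$ an algebraically closed field of characteristic $0$ or coprime to the order of $G$. Let $R=A\oplus A^{sop}$ where $A=M_{n,m}(F)$, with the exchange superinvolution $(a,b)^*=(b,a)$. Then any $G$-grading $R=\bigoplus_{g\in G}R_g$ compatible with $*$ has one of the following types: Type I: $R_g=A_g\oplus A_g^{sop}$ for all $g\in G$, for a $G$-grading $A=\bigoplus_{g\in G}A_g$ of the superalgebra $A$. Type II: $R_g=\{(x,x^{\dagger})\mid x\in A_g\}\oplus\{(x,-x^{\dagger})\mid x\in A_{gh}\}$ for all $g\in G$, where $\dagger$ is a superinvolution on $A$, $A=\bigoplus_{g\in G}A_g$ is a $G$-grading of the superalgebra $A$ with $A_g^\dagger=A_g$ for all $g\in G$, and $h\in G$ is an element of order $2$. Type III: for all $g\in G$, $$R_g=\{(x,x^{\dagger})\mid x\in A_g\cap A_+\}\oplus\{(x,-ix^{\dagger})\mid x\in A_{gh}\cap A_-\}\oplus\{(x,-x^{\dagger})\mid x\in A_{gh^2}\cap A_+\}\oplus\{(x,ix^{\dagger})\mid x\in A_{gh^3}\cap A_-\},$$ where $h$ is an element of order $4$ in $G$, $i\in F$ with $i^2=-1$, $\dagger$ is a superantiautomorphism of order $4$ of $A$, $A=\bigoplus_{g\in G}A_g$ is a $G$-grading of the superalgebra $A$ with $A_g^\dagger=A_g$ for all $g\in G$, and $A_+=\{x\in A\mid (x^\dagger)^\dagger=x\}$, $A_-=\{x\in A\mid (x^\dagger)^\dagger=-x\}$.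
   Context: All algebras are associative. A superalgebra is an associative algebra $A$ with a $\mathbb{Z}_2$-grading $A=A_{\bar 0}\oplus A_{\bar 1}$; for homogeneous $a$, $|a|$ denotes its $\mathbb{Z}_2$-degree. All subalgebras, ideals and homomorphisms of superalgebras are assumed $\mathbb{Z}_2$-graded. $M_{n,m}(F)$ is the matrix algebra $M_{n+m}(F)$ whose even part consists of the block-diagonal matrices with blocks of sizes $n\times n$ and $m\times m$, and whose odd part consists of the block-off-diagonal matrices. A superantiautomorphism of $A$ is a bijective $\mathbb{Z}_2$-graded linear map $\varphi:A\to A$ with $\varphi(xy)=(-1)^{|x||y|}\varphi(y)\varphi(x)$ for homogeneous $x,y$; a superinvolution is a superantiautomorphism $\varphi$ with $\varphi^2=\mathrm{id}$. $A^{sop}$ is the superalgebra with the same $\mathbb{Z}_2$-graded vector space as $A$ and product $a\circ b=(-1)^{|a||b|}ba$ for homogeneous $a,b$. $A\oplus A^{sop}$ is the direct sum of the two ideals, with elements written as pairs $(a,b)$, $a,b\in A$. A $G$-grading of a superalgebra $R$ is a decomposition $R=\bigoplus_{g\in G}R_g$ where each $R_g$ is a $\mathbb{Z}_2$-graded subspace and $R_gR_{g'}\subseteq R_{gg'}$. It is compatible with a superinvolution $*$ if $R_g^*=R_g$ for all $g\in G$. If $A=\bigoplus_{g\in G} A_g$ is a $G$-grading with $G$ abelian, $A_g^{sop}$ denotes the same subspace $A_g$ viewed in $A^{sop}$; these give a $G$-grading of $A^{sop}$. *)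

(* Defs.v *)
From HB Require Import structures.
From mathcomp Require Import all_boot all_order all_fingroup all_algebra.

Set Implicit Arguments.
Unset Strict Implicit.
Unset Printing Implicit Defensive.

Import GRing.Theory.
Local Open Scope ring_scope.

(* Parities are booleans: false is even, true is odd, and the sum (resp.      *)
(* product) of parities is the exclusive or (+) (resp. the conjunction &&).   *)
Record superAlgebra (F : fieldType) := SuperAlgebra {
  sa_carrier :> vectType F;
  sa_mul : sa_carrier -> sa_carrier -> sa_carrier;
  sa_part : bool -> {vspace sa_carrier};
  sa_mul_linear_r : forall x, linear (sa_mul x);
  sa_mul_linear_l : forall y, linear (sa_mul^~ y);
  sa_mulA : associative sa_mul;
  sa_part_full : (sa_part false + sa_part true = fullv)%VS;
  sa_part_direct : directv (sa_part false + sa_part true);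
  sa_part_mul : forall i j x y, x \in sa_part i -> y \in sa_part j ->
    sa_mul x y \in sa_part (i (+) j)
}.

(* Projection onto the component of parity i along the other component.       *)
Definition sa_proj (F : fieldType) (A : superAlgebra F) (i : bool) : 'End(A) :=
  daddv_pi (sa_part A i) (sa_part A (~~ i)).

Section SuperAlgebraTheory.
Variables (F : fieldType) (A : superAlgebra F).
Implicit Types (x y z : A) (i j : bool).
Local Notation mul := (@sa_mul F A).

Lemma sa_mulDr x y z : mul x (y + z) = mul x y + mul x z.
Proof. by have := sa_mul_linear_r x 1 y z; rewrite !scale1r. Qed.

Lemma sa_mulDl x y z : mul (x + y) z = mul x z + mul y z.
Proof. by have := sa_mul_linear_l z 1 x y; rewrite /= !scale1r. Qed.

Lemma sa_mulr0 x : mul x 0 = 0.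
Proof. by apply: (addIr (mul x 0)); rewrite -sa_mulDr !add0r. Qed.

Lemma sa_mul0r x : mul 0 x = 0.
Proof. by apply: (addIr (mul 0 x)); rewrite -sa_mulDl !add0r. Qed.

Lemma sa_mulZr a x y : mul x (a *: y) = a *: mul x y.
Proof. by have := sa_mul_linear_r x a y 0; rewrite sa_mulr0 !addr0. Qed.

Lemma sa_mulZl a x y : mul (a *: x) y = a *: mul x y.
Proof. by have := sa_mul_linear_l y a x 0; rewrite /= sa_mul0r !addr0. Qed.

Lemma sa_part_disjoint i : (sa_part A i :&: sa_part A (~~ i) = 0)%VS.
Proof.
have /directv_addP E := sa_part_direct A.
by case: i => //=; rewrite capvC.
Qed.

Lemma sa_proj_mem i x : sa_proj A i x \in sa_part A i.
Proof. exact: memv_pi. Qed.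

Lemma sa_projD x : sa_proj A false x + sa_proj A true x = x.
Proof.
by apply: (daddv_pi_add (sa_part_disjoint false)); rewrite sa_part_full memvf.
Qed.

Lemma sa_proj_id i x : x \in sa_part A i -> sa_proj A i x = x.
Proof. exact: daddv_pi_id (sa_part_disjoint i). Qed.

Lemma sa_proj_id0 i x : x \in sa_part A i -> sa_proj A (~~ i) x = 0.
Proof.
move=> xi; have := sa_projD x.
case: i xi => /= xi; rewrite (sa_proj_id xi) => E.
  by apply: (addIr x); rewrite add0r.
by apply: (addrI x); rewrite addr0.
Qed.

Lemma sa_proj_hom i j x : x \in sa_part A i ->
  sa_proj A j x = if j == i then x else 0.
Proof.
move=> xi; case: eqP => [->|]; first exact: sa_proj_id.
by case: j i xi => [] [] // xi _; exact: (sa_proj_id0 xi).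
Qed.

End SuperAlgebraTheory.

(* The bilinear extension of a o b = (-1)^(|a||b|) ba.                        *)
Definition sop_mul (F : fieldType) (A : superAlgebra F) (a b : A) : A :=
  \sum_(i : bool) \sum_(j : bool)
    (-1) ^+ (i && j) *: sa_mul (sa_proj A j b) (sa_proj A i a).

Section Sop.
Variables (F : fieldType) (A : superAlgebra F).
Local Notation circ := (@sop_mul F A).

Lemma sop_mulE i j (a b : A) : a \in sa_part A i -> b \in sa_part A j ->
  circ a b = (-1) ^+ (i && j) *: sa_mul b a.
Proof.
move=> ai bj; rewrite /sop_mul (bigD1 i) //= (bigD1 j) //=.
rewrite !sa_proj_id // big1 ?addr0 => [|k /negPf kj].
  rewrite big1 ?addr0 // => k /negPf ki; rewrite big1 // => l _.
  by rewrite (sa_proj_hom _ ai) ki sa_mulr0 scaler0.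
by rewrite (sa_proj_hom _ bj) kj sa_mul0r scaler0.
Qed.

Lemma sop_mul_linear_r x : linear (circ x).
Proof.
move=> a y z; rewrite /sop_mul scaler_sumr -big_split; apply: eq_bigr => i _ /=.
rewrite scaler_sumr -big_split; apply: eq_bigr => j _ /=.
by rewrite linearP sa_mulDl sa_mulZl scalerDr !scalerA mulrC.
Qed.

Lemma sop_mul_linear_l y : linear (circ^~ y).
Proof.
move=> a x z; rewrite /sop_mul scaler_sumr -big_split; apply: eq_bigr => i _ /=.
rewrite scaler_sumr -big_split; apply: eq_bigr => j _ /=.
by rewrite linearP sa_mulDr sa_mulZr scalerDr !scalerA mulrC.
Qed.

Lemma sop_part_mul i j (x y : A) : x \in sa_part A i -> y \in sa_part A j ->
  circ x y \in sa_part A (i (+) j).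
Proof.
by move=> xi yj; rewrite (sop_mulE xi yj) memvZ // addbC sa_part_mul.
Qed.

Lemma sop_mulDr x y z : circ x (y + z) = circ x y + circ x z.
Proof. by have := sop_mul_linear_r x 1 y z; rewrite !scale1r. Qed.

Lemma sop_mulDl x y z : circ (x + y) z = circ x z + circ y z.
Proof. by have := sop_mul_linear_l z 1 x y; rewrite /= !scale1r. Qed.

Lemma sop_mulA : associative circ.
Proof.
have homA i j k (x y z : A) : x \in sa_part A i -> y \in sa_part A j ->
    z \in sa_part A k -> circ x (circ y z) = circ (circ x y) z.
  move=> xi yj zk.
  rewrite (sop_mulE xi (sop_part_mul yj zk)) (sop_mulE (sop_part_mul xi yj) zk).
  rewrite (sop_mulE xi yj) (sop_mulE yj zk) sa_mulZl sa_mulZr !scalerA sa_mulA.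
  by congr (_ *: _); move: i j k {xi yj zk} => [] [] [] //=;
    rewrite ?expr0 ?expr1 ?mulr1 ?mul1r.
have homA2 j k (x y z : A) : y \in sa_part A j -> z \in sa_part A k ->
    circ x (circ y z) = circ (circ x y) z.
  move=> yj zk; rewrite -(sa_projD x) !sop_mulDl.
  by rewrite !(homA _ _ _ _ _ _ (sa_proj_mem _ _) yj zk).
have homA1 k (x y z : A) : z \in sa_part A k ->
    circ x (circ y z) = circ (circ x y) z.
  move=> zk; rewrite -(sa_projD y) sop_mulDl !sop_mulDr sop_mulDl.
  by rewrite !(homA2 _ _ _ _ _ (sa_proj_mem _ _) zk).
move=> x y z; rewrite -(sa_projD z) !sop_mulDr.
by rewrite !(homA1 _ _ _ _ (sa_proj_mem _ _)).
Qed.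

Definition sop : superAlgebra F :=
  SuperAlgebra sop_mul_linear_r sop_mul_linear_l sop_mulA
    (sa_part_full A) (sa_part_direct A) sop_part_mul.

End Sop.

(* The subspace {(a, b) | a \in U, b \in V}.                                  *)
Definition prodv (F : fieldType) (U1 U2 : vectType F)
    (U : {vspace U1}) (V : {vspace U2}) : {vspace U1 * U2} :=
  ((linfun fst @^-1: U) :&: (linfun snd @^-1: V))%VS.

Lemma mem_prodv (F : fieldType) (U1 U2 : vectType F)
    (U : {vspace U1}) (V : {vspace U2}) (p : U1 * U2) :
  (p \in prodv U V) = (p.1 \in U) && (p.2 \in V).
Proof. by rewrite memv_cap -!memv_preim !lfunE. Qed.

Section DirectSum.
Variables (F : fieldType) (A B : superAlgebra F).
Implicit Types p q : (A * B)%type.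

Definition dsum_mul p q : A * B := (sa_mul p.1 q.1, sa_mul p.2 q.2).
Definition dsum_part i : {vspace A * B} := prodv (sa_part A i) (sa_part B i).

Lemma dsum_mul_linear_r p : linear (dsum_mul p).
Proof.
by move=> a q r; rewrite /dsum_mul /= !sa_mulDr !sa_mulZr.
Qed.

Lemma dsum_mul_linear_l q : linear (dsum_mul^~ q).
Proof.
by move=> a p r; rewrite /dsum_mul /= !sa_mulDl !sa_mulZl.
Qed.

Lemma dsum_mulA : associative dsum_mul.
Proof. by move=> p q r; rewrite /dsum_mul /= !sa_mulA. Qed.

Lemma dsum_part_full : (dsum_part false + dsum_part true = fullv)%VS.
Proof.
apply/eqP; rewrite eqEsubv subvf; apply/subvP => -[a b] _; apply/memv_addP.
exists (sa_proj A false a, sa_proj B false b).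
  by rewrite mem_prodv !sa_proj_mem.
exists (sa_proj A true a, sa_proj B true b).
  by rewrite mem_prodv !sa_proj_mem.
by rewrite -{1}(sa_projD a) -{1}(sa_projD b).
Qed.

Lemma dsum_part_direct : directv (dsum_part false + dsum_part true).
Proof.
apply/directv_addP/eqP; rewrite -subv0; apply/subvP => -[a b].
rewrite memv_cap !mem_prodv /= memv0 => /andP[/andP[a0 b0] /andP[a1 b1]].
have : a \in (sa_part A false :&: sa_part A true)%VS by rewrite memv_cap a0.
have : b \in (sa_part B false :&: sa_part B true)%VS by rewrite memv_cap b0.
rewrite (sa_part_disjoint A false) (sa_part_disjoint B false) !memv0.
by move=> /eqP-> /eqP->.
Qed.

Lemma dsum_part_mul i j p q : p \in dsum_part i -> q \in dsum_part j ->
  dsum_mul p q \in dsum_part (i (+) j).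
Proof.
rewrite !mem_prodv => /andP[p1 p2] /andP[q1 q2].
by rewrite !sa_part_mul.
Qed.

Definition dsum : superAlgebra F :=
  SuperAlgebra dsum_mul_linear_r dsum_mul_linear_l dsum_mulA
    dsum_part_full dsum_part_direct dsum_part_mul.

End DirectSum.

Section MatrixSuperAlgebra.
Variables (F : fieldType) (n m : nat).
Local Notation M := 'M[F]_(n + m).

(* The submatrices are written as compositions because ulsubmx & co. do not   *)
(* carry a canonical linear structure; see mem_mxs_part.                      *)
Definition mxs_part (i : bool) : {vspace M} :=
  if i then (lker (linfun (@lsubmx F n n m \o @usubmx F n m (n + m)))
             :&: lker (linfun (@rsubmx F m n m \o @dsubmx F n m (n + m))))%VS
  else (lker (linfun (@rsubmx F n n m \o @usubmx F n m (n + m)))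
        :&: lker (linfun (@lsubmx F m n m \o @dsubmx F n m (n + m))))%VS.

Lemma mem_mxs_part i (x : M) : (x \in mxs_part i) =
  if i then (ulsubmx x == 0) && (drsubmx x == 0)
  else (ursubmx x == 0) && (dlsubmx x == 0).
Proof. by case: i; rewrite memv_cap !memv_ker !lfunE. Qed.

Lemma mxs_mul_linear_r (x : M) : linear (mulmx x : M -> M).
Proof. exact: linearP. Qed.

Lemma mxs_mul_linear_l (y : M) : linear ((fun x => x *m y) : M -> M).
Proof. by move=> a x z; rewrite mulmxDl scalemxAl. Qed.

Lemma mxs_mulA : associative (mulmx : M -> M -> M).
Proof. exact: mulmxA. Qed.

Lemma mxs_part_full : (mxs_part false + mxs_part true = fullv)%VS.
Proof.
apply/eqP; rewrite eqEsubv subvf; apply/subvP => x _; apply/memv_addP.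
exists (block_mx (ulsubmx x) 0 0 (drsubmx x)).
  by rewrite mem_mxs_part block_mxKur block_mxKdl !eqxx.
exists (block_mx 0 (ursubmx x) (dlsubmx x) 0).
  by rewrite mem_mxs_part block_mxKul block_mxKdr !eqxx.
by rewrite add_block_mx !addr0 !add0r submxK.
Qed.

Lemma mxs_part_direct : directv (mxs_part false + mxs_part true).
Proof.
apply/directv_addP/eqP; rewrite -subv0; apply/subvP => x.
rewrite memv_cap !mem_mxs_part memv0.
move=> /andP[/andP[/eqP ur /eqP dl] /andP[/eqP ul /eqP dr]].
by rewrite -[x]submxK ur dl ul dr block_mx0.
Qed.

Lemma mxs_part_mul i j (x y : M) : x \in mxs_part i -> y \in mxs_part j ->
  x *m y \in mxs_part (i (+) j).
Proof.
rewrite -[x]submxK -[y]submxK !mem_mxs_part mulmx_block.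
case: i; case: j => /=; rewrite ?block_mxKul ?block_mxKur ?block_mxKdl
  ?block_mxKdr => /andP[/eqP-> /eqP->] /andP[/eqP-> /eqP->];
  by rewrite !mulmx0 !mul0mx !addr0 !eqxx.
Qed.

Definition mxs : superAlgebra F :=
  SuperAlgebra mxs_mul_linear_r mxs_mul_linear_l mxs_mulA
    mxs_part_full mxs_part_direct mxs_part_mul.

End MatrixSuperAlgebra.

Section SuperAntiAutomorphisms.
Variables (F : fieldType) (A : superAlgebra F).
Implicit Type f : 'End(A).

Definition superantiautomorphism f : Prop :=
  [/\ bijective f,
      forall i x, x \in sa_part A i -> f x \in sa_part A i
    & forall i j x y, x \in sa_part A i -> y \in sa_part A j ->
        f (sa_mul x y) = (-1) ^+ (i && j) *: sa_mul (f y) (f x)].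

Definition superinvolution f : Prop :=
  superantiautomorphism f /\ forall x, f (f x) = x.

Definition has_order f (k : nat) : Prop :=
  [/\ (0 < k)%N, forall x, iter k f x = x
    & forall l, (0 < l < k)%N -> ~ (forall x, iter l f x = x)].

Definition plus_space f : {vspace A} := fixedSpace (f \o f)%VF.
Definition minus_space f : {vspace A} := lker ((f \o f)%VF + \1%VF).

Lemma plus_spaceP f x : reflect (f (f x) = x) (x \in plus_space f).
Proof. by apply: (iffP fixedSpaceP); rewrite comp_lfunE. Qed.

Lemma minus_spaceP f x : reflect (f (f x) = - x) (x \in minus_space f).
Proof.
rewrite memv_ker add_lfunE comp_lfunE id_lfunE addr_eq0; exact: eqP.
Qed.

End SuperAntiAutomorphisms.

Section Exchange.
Variables (F : fieldType) (A : superAlgebra F).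

Definition swap (p : dsum A (sop A)) : dsum A (sop A) := (p.2, p.1).

Lemma swap_linear : linear swap. Proof. by []. Qed.
HB.instance Definition _ :=
  GRing.isLinear.Build F (dsum A (sop A)) (dsum A (sop A)) _ swap swap_linear.

Definition exchange : 'End(dsum A (sop A)) := linfun swap.

Lemma exchangeE (a b : A) : exchange (a, b) = (b, a).
Proof. by rewrite lfunE. Qed.

Lemma exchange_superinvolution : superinvolution exchange.
Proof.
have K x : exchange (exchange x) = x by case: x => a b; rewrite !exchangeE.
split=> //; split; first by exists exchange.
  by move=> i [a b]; rewrite exchangeE !mem_prodv andbC.
move=> i j [a b] [c d]; rewrite !mem_prodv /= => /andP[ai bi] /andP[cj dj].
rewrite !exchangeE /= /dsum_mul /=.
rewrite (sop_mulE bi dj) (sop_mulE cj ai) [j && i]andbC.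
by congr (_, _); rewrite scalerA -signr_addb addbb scale1r.
Qed.

(* The subspace {(x, f x) | x \in U}.                                         *)
Definition pair_fun (f : 'End(A)) (x : A) : dsum A (sop A) := (x, f x).

Lemma pair_fun_linear f : linear (pair_fun f).
Proof. by move=> a x y; rewrite /pair_fun linearP. Qed.
HB.instance Definition _ f :=
  GRing.isLinear.Build F A (dsum A (sop A)) _ (pair_fun f) (pair_fun_linear f).

Definition graphv (U : {vspace A}) (f : 'End(A)) : {vspace dsum A (sop A)} :=
  (linfun (pair_fun f) @: U)%VS.

Lemma graphvP (U : {vspace A}) (f : 'End(A)) (p : dsum A (sop A)) :
  reflect (exists2 x, x \in U & p = (x, f x)) (p \in graphv U f).
Proof.
by apply: (iffP memv_imgP) => -[x xU ->]; exists x => //; rewrite lfunE.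
Qed.

End Exchange.

Section Gradings.
Variables (F : fieldType) (G : finGroupType).

Definition Z2_graded_subspace (A : superAlgebra F) (U : {vspace A}) : Prop :=
  U = (U :&: sa_part A false + U :&: sa_part A true)%VS.

Definition is_grading (A : superAlgebra F) (Gam : G -> {vspace A}) : Prop :=
  [/\ (\sum_g Gam g = fullv)%VS,
      directv (\sum_g Gam g),
      forall g, Z2_graded_subspace (Gam g)
    & forall g g' x y, x \in Gam g -> y \in Gam g' ->
        sa_mul x y \in Gam (g * g')%g].

Definition grading_compatible (A : superAlgebra F) (f : 'End(A))
    (Gam : G -> {vspace A}) : Prop :=
  forall g, (f @: Gam g)%VS = Gam g.

(* W is the internal direct sum of the subspaces listed in s.                 *)
Definition direct_sum_of (V : vectType F) (W : {vspace V})
    (s : seq {vspace V}) : Prop :=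
  W = (\sum_(U <- s) U)%VS /\ directv (\sum_(U <- s) U).

Variable A : superAlgebra F.
Implicit Type R : G -> {vspace dsum A (sop A)}.

Definition type_I R : Prop :=
  exists Gam : G -> {vspace A},
    is_grading Gam /\ forall g, R g = prodv (Gam g) (Gam g).

Definition type_II R : Prop :=
  exists (dag : 'End(A)) (Gam : G -> {vspace A}) (h : G),
    [/\ superinvolution dag,
        is_grading Gam,
        grading_compatible dag Gam,
        #[h]%g = 2%N
      & forall g, direct_sum_of (R g)
          [:: graphv (Gam g) dag; graphv (Gam (g * h)%g) (- dag)]].

Definition type_III R : Prop :=
  exists (dag : 'End(A)) (Gam : G -> {vspace A}) (h : G) (i : F),
    [/\ superantiautomorphism dag /\ has_order dag 4,
        is_grading Gam,
        grading_compatible dag Gam,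
        #[h]%g = 4%N /\ i ^+ 2 = -1
      & forall g, direct_sum_of (R g)
          [:: graphv (Gam g :&: plus_space dag) dag;
              graphv (Gam (g * h)%g :&: minus_space dag) (- (i *: dag));
              graphv (Gam (g * h ^+ 2)%g :&: plus_space dag) (- dag);
              graphv (Gam (g * h ^+ 3)%g :&: minus_space dag) (i *: dag)]].

End Gradings.

(* Main.v *)
(* The components of the central idempotent (1, 0) of R are pairs of scalars, so
   either (1, 0) has degree 1, which gives Type I, or (1, -1) is homogeneous of
   some degree h of order 2, and multiplying by it sends (a, b) in R_g to
   (a, -b) in R_(gh).

   In the second case, let dag be a superantiautomorphism of A with dag^4 = 1
   such that (dag, dag) preserves every R_g. Then R_g is the sum of the
   eigenspaces of (a, b) |-> (dag b, dag a). This is Type II when dag^2 = 1,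
   and Type III when dag^2 <> 1 and h is a square t^2, where t is then the
   element of order 4.

   To find dag, let chi be a character of G with chi(h) = -1. Multiplication by
   chi(g) on {x | (x, x) in R_g} defines a superantiautomorphism phi of A. If h
   is not a square, chi can be taken of order 2 and dag = phi works. In general,
   multiplying phi by i on the odd part gives an ordinary antiautomorphism
   X |-> T X^T T^-1 of the matrix algebra, and P = T T^-T is diagonalizable and
   fixed by all automorphisms commuting with this antiautomorphism, in
   particular by those given by the characters of G equal to 1 at h. A suitable function Q of P
   satisfies Q^4 = P^2 and phi(Q) = Q^-1, and then dag x = Q^-1 phi(x) Q. *)
From HB Require Import structures.
Require Import Defs.
From mathcomp Require Import all_boot all_order all_fingroup all_algebra.
From mathcomp Require Import cyclic separable mxrepresentation.
Set Implicit Arguments.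
Unset Strict Implicit.
Unset Printing Implicit Defensive.
Import GRing.Theory.
Local Open Scope ring_scope.

(** * Matrices and antiautomorphisms *)

(** Commutation with the matrix unit [delta_mx j 0], read at the entry (i, 0), says that [A i j] is
    [A 0 0] if i = j and 0 otherwise. *)
Lemma scalar_mx_commute (F : fieldType) (n : nat) (A : 'M[F]_n) :
  (forall X : 'M[F]_n, A *m X = X *m A) -> is_scalar_mx A.
Proof.
case: n A => [|n] A AC; first by rewrite thinmx0 mx0_is_scalar.
apply/is_scalar_mxP; exists (A 0 0); apply/matrixP => i j; rewrite mxE.
have /matrixP/(_ i 0) := AC (delta_mx j 0).
rewrite !mxE (bigD1 j) //= [X in _ = X](bigD1 0) //= !mxE !eqxx.
rewrite !big1 => [|k /negPf k0|k /negPf kj]; last 2 first.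
- by rewrite mxE k0 andbF mul0r.
- by rewrite mxE kj mulr0.
by rewrite mulr1 !addr0 andbT => ->; rewrite mulr_natl; case: eqP.
Qed.

(** X^k - s is separable because k and s are nonzero in F, so the minimal polynomial of [A], which
    divides it, splits with simple roots. *)
Lemma diagonalizable_of_expr (F : closedFieldType) (n k : nat) (s : F)
    (A : 'M[F]_n) : k%:R != 0 :> F -> s != 0 -> A ^+ k = s%:M ->
  exists2 U : 'M[F]_n, U \in unitmx & exists d : 'rV[F]_n,
    U *m A = diag_mx d *m U.
Proof.
case: n A => [|n] A k0 s0 Ak.
  exists 0; first by rewrite unitmxE det_mx00 unitr1.
  by exists 0; rewrite thinmx0 [RHS]thinmx0.
have k_gt0 : (0 < k)%N by case: k k0 {Ak} => //; rewrite eqxx.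
pose p : {poly F} := 'X^k - s%:P.
have [rs] := closed_field_poly_normal p.
rewrite lead_coefXnsubC // scale1r => defp.
have /diagonalizableP[U Uu] : exists2 rs : seq F, uniq rs &
    mxminpoly A %| \prod_(x <- rs) ('X - x%:P).
  exists rs; last first.
    rewrite -defp; apply: mxminpoly_min.
    by rewrite rmorphB rmorphXn /= horner_mx_X horner_mx_C Ak subrr.
  rewrite -separable_prod_XsubC -defp separable_poly.unlock.
  (* With derivative k X^(k-1), the Bezout identity is -(X^k - s) + (X/k) (k X^(k-1)) = s. *)
  apply/Bezout_coprimepP; exists (-1, (k%:R)^-1 *: 'X) => /=.
  rewrite derivB derivXn derivC subr0 -scaler_nat -scalerAl -scalerAr.
  rewrite scalerA mulVf // scale1r -exprS prednK // mulN1r opprB subrK.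
  by rewrite -size_poly_eq1 size_polyC s0.
case/similar_diagPex => d /(similarP Uu) E.
by exists U => //; exists d.
Qed.

(* The columns of T are the images of a vector under the matrix units of the *)
(* first column, as transported by [f].                                      *)
Lemma skolem_noether (F : fieldType) (n : nat) (f : 'M[F]_n -> 'M[F]_n) :
    linear f -> {morph f : X Y / X *m Y} -> f 1%:M = 1%:M ->
  exists2 T : 'M[F]_n, T \in unitmx & forall X, f X *m T = T *m X.
Proof.
case: n f => [|n'] f lf fM f1.
  exists 0; first by rewrite unitmxE det_mx00 unitr1.
  by move=> X; rewrite thinmx0 [RHS]thinmx0.
pose hf := GRing.isLinear.Build F _ _ _ f lf.
pose g : {linear 'M[F]_n'.+1 -> 'M[F]_n'.+1} := HB.pack f hf.
have fZ a X : f (a *: X) = a *: f X := GRing.scalable_linear lf a X.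
have fS (I : finType) (E : I -> 'M[F]_n'.+1) :
    f (\sum_i E i) = \sum_i f (E i) := raddf_sum g _ _ _.
(* If every column of f(E_00) vanished, then f(1) would be the sum of the f(E_i0) f(E_00) f(E_0i),
   hence 0. *)
have [j fj] : exists j, f (delta_mx 0 0) *m delta_mx j 0 != 0 :> 'cV_n'.+1.
  apply/existsP; rewrite -[[exists _, _]]negbK negb_exists.
  apply/negP => /forallP H.
  have f00 : f (delta_mx 0 0) = 0.
    apply/matrixP => i j; have /negPn/eqP/matrixP/(_ i 0) := H j.
    by rewrite -colE !mxE.
  have : f 1%:M = 0.
    rewrite mx1_sum_delta fS big1 // => i _.
    rewrite -(mul_delta_mx (0 : 'I_n'.+1)) fM.
    by rewrite -(mul_delta_mx (0 : 'I_n'.+1) 0 i) fM f00 mul0mx mulmx0.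
  by rewrite f1 => /eqP; rewrite oner_eq0.
pose u : 'cV[F]_n'.+1 := delta_mx j 0.
pose T : 'M[F]_n'.+1 := \matrix_(a, b) (f (delta_mx b 0) *m u) a 0.
have colT b : col b T = f (delta_mx b 0) *m u.
  by apply/colP => a; rewrite !mxE.
have fT X : f X *m T = T *m X.
  apply/matrixP => a b.
  have -> : (f X *m T) a b = (f X *m col b T) a 0.
    by rewrite !mxE; apply: eq_bigr => k _; rewrite !mxE.
  rewrite colT mulmxA -fM.
  have -> : X *m (delta_mx b 0 : 'M_n'.+1) = \sum_k X k b *: delta_mx k 0.
    rewrite {1}[X]matrix_sum_delta mulmx_suml; apply: eq_bigr => k _.
    rewrite mulmx_suml (bigD1 b) //= big1 ?addr0 => [|c /negPf cb].
      by rewrite -scalemxAl mul_delta_mx.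
    by rewrite -scalemxAl mul_delta_mx_0 ?scaler0 // cb.
  rewrite fS mulmx_suml summxE mxE; apply: eq_bigr => k _.
  by rewrite fZ -scalemxAl !mxE mulrC.
(* If T w = 0 with w_k nonzero, then w_k T e_0 = T E_0k w = f(E_0k) T w = 0, although T e_0 =
   f(E_00) u is nonzero. *)
exists T => //; rewrite -unitmx_tr -row_free_unit -kermx_eq0.
apply: contraNT fj => /rowV0Pn[w /sub_kermxP wT w0].
have /rV0Pn[k wk] := w0.
have Tw : T *m w^T = 0 by rewrite -[T]trmxK -trmx_mul wT trmx0.
have := colT 0; rewrite -/u => <-; apply/eqP.
apply: (scalerI wk); rewrite scaler0 colE scalemxAr.
have <- : delta_mx 0 k *m w^T = w 0 k *: delta_mx 0 0 :> 'cV_n'.+1.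
  apply/colP => a; rewrite !mxE (bigD1 k) //= big1 ?addr0 => [|c /negPf ck].
    by rewrite !mxE eqxx !andbT mulrC.
  by rewrite !mxE ck andbF mul0r.
by rewrite mulmxA -fT -mulmxA Tw mulmx0.
Qed.

(* A square root s of l satisfies s(l) s(1/l) = 1 up to a sign; multiplying   *)
(* it by i when the sign is wrong costs f(l)^2 = l, but not f(l)^4 = l^2.     *)
Lemma reciprocal_fourth_root (F : closedFieldType) : exists f : F -> F,
  forall l, l != 0 -> f l ^+ 4 = l ^+ 2 /\ f l * f l^-1 = 1.
Proof.
have sqrt_ex (l : F) : exists s, s ^+ 2 == l.
  have [s] := @solve_monicpoly F 2 (nth 0 [:: l]) isT.
  rewrite !big_ord_recl big_ord0 /= expr0 mulr1 mul0r !addr0 => <-.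
  by exists s.
pose s l := xchoose (sqrt_ex l).
have s2 l : s l ^+ 2 = l := eqP (xchooseP (sqrt_ex l)).
pose f l := if s l * s l^-1 == 1 then s l else s (-1) * s l.
exists f => l l0.
have : (s l * s l^-1) ^+ 2 == 1 by rewrite exprMn !s2 divff.
rewrite sqrf_eq1 /f invrK [s l^-1 * s l]mulrC.
case: (altP (s l * s l^-1 =P 1)) => [-> _|_ /= /eqP E].
  by rewrite -[4%N]/(2 * 2)%N exprM s2.
rewrite mulrACA E -expr2 s2 mulN1r opprK; split=> //.
by rewrite exprMn -[4%N]/(2 * 2)%N !exprM !s2 sqrrN expr1n mul1r.
Qed.

Section Antiautomorphism.
Variables (F : closedFieldType) (N : nat).
Implicit Types X Y : 'M[F]_N.

(* With phi X = T X^T T^-1, the matrix P = T T^-T implements phi^2 and is     *)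
(* fixed by every automorphism commuting with phi; Q is a function of P.      *)
Lemma antiautomorphism_root (k : nat) (phi : 'M[F]_N -> 'M[F]_N) :
    k%:R != 0 :> F -> linear phi ->
    (forall X Y, phi (X *m Y) = phi Y *m phi X) -> phi 1%:M = 1%:M ->
    (forall X, iter k (phi \o phi) X = X) ->
  exists P Q : 'M[F]_N,
    [/\ P \in unitmx /\ (forall X, phi (phi X) *m P = P *m X),
        Q *m P = P *m Q, Q *m Q *m (Q *m Q) = P *m P,
        phi Q *m Q = 1%:M
      & forall f : 'M[F]_N -> 'M[F]_N, linear f ->
          {morph f : X Y / X *m Y} -> f 1%:M = 1%:M ->
          (forall X, f (phi X) = phi (f X)) -> f P = P /\ f Q = Q].
Proof.
move=> k0 lphi phiM phi1 phi2k.
(* Composing with the transpose turns the antiautomorphism into an automorphism, which is inner. *)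
have [T Tu TE] : exists2 T : 'M[F]_N, T \in unitmx &
    forall X, phi X^T *m T = T *m X.
  apply: skolem_noether => [a X Y|X Y|].
  - by rewrite linearP lphi.
  - by rewrite trmx_mul phiM.
  - by rewrite trmx1.
have phiE X : phi X = T *m X^T *m invmx T.
  by rewrite -{2}[X]trmxK -[X^T^T]/((X^T)^T) trmxK -TE trmxK mulmxK.
have TTu : T^T \in unitmx by rewrite unitmx_tr.
have [P PT] : exists P, P = T *m invmx T^T by exists (T *m invmx T^T).
have Pu : P \in unitmx by rewrite PT unitmx_mul Tu unitmx_inv.
have PE X : phi (phi X) *m P = P *m X.
  rewrite !phiE !trmx_mul trmxK trmx_inv PT !mulmxA.
  by rewrite (mulmxKV Tu) (mulmxK TTu).
(* [P ^+ k] implements the k-th iterate of phi^2, the identity, so it is central and therefore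
   scalar. *)
have Pk : exists2 s, s != 0 & P ^+ k = s%:M.
  have Pj j X : iter j (phi \o phi) X *m P ^+ j = P ^+ j *m X.
    elim: j X => [|j IH] X /=; first by rewrite expr0 mulmx1 mul1mx.
    by rewrite exprS -mulmxE mulmxA PE -!mulmxA IH.
  have /is_scalar_mxP[s Es] : is_scalar_mx (P ^+ k).
    by apply: scalar_mx_commute => X; rewrite -Pj phi2k.
  have : P ^+ k \in unitmx.
    by elim: (k) => [|j IH]; rewrite ?unitmx1 // exprS -mulmxE unitmx_mul Pu.
  (* An invertible matrix equals the scalar 0 only in size 0, where 1 serves as the scalar just as
     well. *)
  case: (eqVneq s 0) => [s0|s0 _]; last by exists s.
  rewrite Es s0 raddf0 unitmxE => detu; exists 1; first exact: oner_neq0.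
  apply/matrixP => i; case: (N) i detu => [[]|N'] i //.
  by rewrite det0 unitr0.
have [s s0 Es] := Pk; have [U Uu [d Ud]] := diagonalizable_of_expr k0 s0 Es.
have [f fE] := reciprocal_fourth_root F.
have defP : P = invmx U *m diag_mx d *m U by rewrite -mulmxA -Ud mulKmx.
have d0 i : d 0 i != 0.
  have : diag_mx d \in unitmx.
    have : U *m P \in unitmx by rewrite unitmx_mul Uu.
    by rewrite Ud unitmx_mul => /andP[].
  by rewrite unitmxE det_diag unitfE => /prodf_neq0/(_ i isT).
pose fd : 'rV[F]_N := \row_i f (d 0 i).
have [Q QE] : exists Q, Q = invmx U *m diag_mx fd *m U.
  by exists (invmx U *m diag_mx fd *m U).
(* In an eigenbasis of P, a nonzero entry (i, j) of a matrix commuting with P forces d_i = d_j,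
   hence f(d_i) = f(d_j). *)
have QP_comm X : X *m P = P *m X -> X *m Q = Q *m X.
  move=> XP; have [Y YE] :
    exists Y, Y = U *m X *m invmx U by exists (U *m X *m invmx U).
  have defX : X = invmx U *m Y *m U
    by rewrite YE !mulmxA mulVmx // mul1mx mulmxKV.
  suff YQ : Y *m diag_mx fd = diag_mx fd *m Y.
    rewrite defX QE !mulmxA !(mulmxK Uu) -!(mulmxA (invmx U)).
    by rewrite YQ.
  have YP : Y *m diag_mx d = diag_mx d *m Y.
    have -> : diag_mx d = U *m P *m invmx U by rewrite Ud mulmxK.
    rewrite YE !mulmxA !(mulmxKV Uu) -!mulmxA; congr (_ *m _).
    by rewrite !mulmxA XP.
  apply/matrixP => i j; rewrite mul_mx_diag mul_diag_mx !mxE.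
  have /matrixP/(_ i j) := YP; rewrite mul_mx_diag mul_diag_mx !mxE.
  case: (eqVneq (Y i j) 0) => [-> _|Y0]; first by rewrite mulr0 mul0r.
  by rewrite [X in X = _]mulrC => /(mulIf Y0) ->; rewrite mulrC.
exists P, Q; split=> //.
- by rewrite QP_comm.
- rewrite QE defP !mulmxA !(mulmxK Uu); congr (_ *m _).
  rewrite -!mulmxA; congr (_ *m _); rewrite !mulmx_diag; congr diag_mx.
  apply/rowP => i; rewrite !mxE; have [+ _] := fE _ (d0 i).
  by rewrite !exprS expr0 !mulr1.
(* From P T P^T = T, the matrix Y = U T U^T satisfies d_i Y_ij d_j = Y_ij. So Y_ij nonzero forces
   d_j = 1/d_i, and then f(d_i) f(d_j) = 1. This gives Q T Q^T = T, that is, Q phi(Q) = 1. *)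
- have QTQ : Q *m T *m Q^T = T.
    have [Y YE] : exists Y, Y = U *m T *m U^T by exists (U *m T *m U^T).
    have defT : T = invmx U *m Y *m invmx U^T.
      by rewrite YE !mulmxA mulVmx // mul1mx mulmxK // unitmx_tr.
    have UTu : U^T \in unitmx by rewrite unitmx_tr.
    have YP : diag_mx d *m Y *m diag_mx d = Y.
      have PTP : P *m T *m P^T = T.
        by rewrite PT trmx_mul trmx_inv trmxK !mulmxA (mulmxK Tu) (mulmxKV TTu).
      have dU : U^T *m diag_mx d = P^T *m U^T.
        by rewrite -trmx_mul Ud trmx_mul tr_diag_mx.
      rewrite YE -!mulmxA dU !mulmxA -Ud -{2}PTP.
      by rewrite !mulmxA.
    rewrite QE {1}defT !trmx_mul trmx_inv tr_diag_mx !mulmxA (mulmxK Uu).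
    rewrite (mulmxKV UTu) defT; congr (_ *m _).
    rewrite -!mulmxA; congr (_ *m _); rewrite mulmxA.
    apply/matrixP => i j; rewrite mul_mx_diag mul_diag_mx !mxE.
    have /matrixP/(_ i j) := YP; rewrite mul_mx_diag mul_diag_mx !mxE.
    case: (eqVneq (Y i j) 0) => [-> _|Y0]; first by rewrite mulr0 mul0r.
    rewrite mulrAC => /(canRL (mulfK Y0)); rewrite divff // => dd.
    have -> : d 0 j = (d 0 i)^-1 by apply: (mulfI (d0 i)); rewrite dd divff.
    by rewrite mulrAC (fE _ (d0 i)).2 mul1r.
  by rewrite phiE; apply: mulmx1C; rewrite !mulmxA QTQ mulmxV.
- move=> g lg gM g1 gphi.
  have [V Vu VE] := skolem_noether lg gM g1.
  have VTu : V^T \in unitmx by rewrite unitmx_tr.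
  have gE X : g X = V *m X *m invmx V by rewrite -VE mulmxK.
  (* For g the conjugation by V, commuting with phi means that V^T T^-1 V T is central. The
     resulting scalar identity and its transpose together give V P = P V. *)
  have /is_scalar_mxP[c W] : is_scalar_mx (V^T *m invmx T *m V *m T).
    apply: scalar_mx_commute => X.
    have := gphi X^T; rewrite !gE !phiE !trmx_mul trmx_inv trmxK => E.
    have := congr1 (fun Z => V^T *m invmx T *m Z *m V *m T) E.
    by rewrite !mulmxA !(mulmxKV Vu) !(mulmxKV Tu) (mulmxV VTu) mul1mx.
  have VP : V *m P = P *m V.
    have E1 : V *m T = c *: (T *m invmx V^T).
      have := W; rewrite -!mulmxA => /(canRL (mulKmx VTu)).
      by rewrite mul_mx_scalar => /(canRL (mulKVmx Tu)); rewrite -scalemxAr.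
    have E2 : invmx T^T *m V = c *: (invmx V^T *m invmx T^T).
      have := congr1 trmx W; rewrite tr_scalar_mx !trmx_mul trmxK trmx_inv.
      move/(canRL (mulKmx TTu)); rewrite mul_mx_scalar.
      by move/(canRL (mulKmx VTu)); rewrite -scalemxAr.
    by rewrite PT mulmxA E1 -mulmxA E2 -scalemxAl -scalemxAr mulmxA.
  have fixV X : V *m X = X *m V -> g X = X.
    by move=> VX; rewrite gE VX mulmxK.
  by split; apply: fixV => //; apply: QP_comm.
Qed.
End Antiautomorphism.

(** * Characters *)

Definition multiplicative_char (gT : finGroupType) (F : fieldType)
    (chi : gT -> F) : Prop :=
  chi 1%g = 1 /\ {morph chi : x y / (x * y)%g >-> x * y}.

Section MultiplicativeChar.
Variables (gT : finGroupType) (F : fieldType) (chi : gT -> F).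
Hypothesis chiP : multiplicative_char chi.

Lemma mchar1 : chi 1%g = 1. Proof. by case: chiP. Qed.
Lemma mcharM x y : chi (x * y)%g = chi x * chi y. Proof. by case: chiP. Qed.
Lemma mcharX k x : chi (x ^+ k)%g = chi x ^+ k.
Proof.
elim: k => [|k IH]; first by rewrite expg0 expr0 mchar1.
by rewrite expgS exprS mcharM IH.
Qed.
Lemma mchar_neq0 x : chi x != 0.
Proof.
have := mcharM x x^-1%g; rewrite mulgV mchar1 => /eqP; apply: contraTneq => ->.
by rewrite mul0r oner_eq0.
Qed.
Lemma mchar_expn x : chi x ^+ #|[set: gT]| = 1.
Proof. by rewrite -mcharX (eqP (_ :
  x ^+ _ == 1)%g) ?mchar1 // -order_dvdn order_dvdG ?inE. Qed.

End MultiplicativeChar.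

(* A common eigenvector of the regular representation gives a character. *)
Lemma multiplicative_char_separates (gT : finGroupType) (F : closedFieldType)
    (h : gT) :
    abelian [set: gT] -> #|[set: gT]|%:R != 0 :> F -> h != 1%g ->
  exists2 chi : gT -> F, multiplicative_char chi & chi h != 1.
Proof.
move=> abG G0 h1; pose rG := regular_repr F [set: gT]%G.
have rX k x : rG (x ^+ k)%g = rG x ^+ k.
  elim: k => [|k IH]; first by rewrite expg0 repr_mx1.
  by rewrite expgS exprS -mulmxE -IH repr_mxM ?inE.
(* The matrices [rG x] commute, and each is diagonalizable because its power of exponent |G| is 1
   and |G| is invertible in F. One basis diagonalizes them all, and each diagonal position is a
   character. *)
have [|U Uu Udiag] := (codiagonalizableP [seq rG x | x : gT]).1.
  split=> [_ _ /mapP[x _ ->] /mapP[y _ ->]|_ /mapP[x _ ->]].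
    rewrite /comm_mx -!repr_mxM ?inE //; congr (rG _).
    by apply: (centsP abG); rewrite inE.
  have [|V Vu [d Vd]] := @diagonalizable_of_expr F _ _ 1 (rG x) G0 (oner_neq0
    _).
    rewrite -rX (eqP (_ : x ^+ _ == 1)%g) ?repr_mx1 //.
    by rewrite -order_dvdn order_dvdG ?inE.
  by exists V => //; apply/similar_diagPex; exists d; apply/similarP.
have diag x : exists d, U *m rG x = diag_mx d *m U.
  have /(allP Udiag)/similar_diagPex[d /(similarP Uu) E] :
      rG x \in [seq rG x | x : gT] by apply: map_f; rewrite mem_enum.
  by exists d.
pose d x := U *m rG x *m invmx U.
have dE x i j : d x i j = d x i i *+ (i == j).
  rewrite /d; have [e ->] := diag x.
  by rewrite mulmxK // !mxE eqxx mulr1n.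
have dM x y : d (x * y)%g = d x *m d y.
  by rewrite /d repr_mxM ?inE // !mulmxA mulmxKV.
have d1 : d 1%g = 1%:M by rewrite /d repr_mx1 mulmx1 mulmxV.
have [i di] : exists i, d h i i != 1.
  apply/existsP; apply: contraNT h1; rewrite negb_exists => /forallP dh.
  have dh1 : d h = 1%:M.
    apply/matrixP => i j; rewrite dE [RHS]mxE; congr (_ *+ _).
    by have /negPn/eqP := dh i.
  have rh1 : rG h = 1%:M.
    have -> : rG h = invmx U *m d h *m U
      by rewrite /d !mulmxA mulVmx // mul1mx mulmxKV.
    by rewrite dh1 mulmx1 mulVmx.
  have /subsetP/(_ h) := regular_mx_faithful F [set: gT]%G.
  by rewrite !inE rh1 mul1mx eqxx => /(_ isT).
exists (fun x => d x i i) => //; split; first by rewrite d1 mxE eqxx.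
move=> x y /=; rewrite dM mxE (bigD1 i) //= big1 ?addr0 // => j /negPf ij.
by rewrite dE eq_sym ij mul0r.
Qed.

Section Involution.
Variables (gT : finGroupType) (F : closedFieldType) (h : gT).
Hypotheses (abG : abelian [set: gT]) (G0 : #|[set: gT]|%:R != 0 :> F).

Lemma multiplicative_char_involution : #[h]%g = 2%N ->
  exists2 chi : gT -> F, multiplicative_char chi & chi h = -1.
Proof.
move=> h2; have h1 : h != 1%g by rewrite -order_eq1 h2.
have [chi chiP chih] := multiplicative_char_separates abG G0 h1.
exists chi => //; have /eqP := mcharX chiP 2 h.
rewrite -h2 expg_order (mchar1 chiP) h2 eq_sym sqrf_eq1 (negPf chih) => /eqP.
by [].
Qed.

(** A non-square h has a nontrivial class in the quotient of G by its subgroup of squares. A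
    character of that quotient which is not 1 at this class is pulled back to G; its values square
    to 1. *)
Lemma sign_char_nonsquare : (forall g : gT, g ^+ 2 != h)%g ->
  exists2 chi : gT -> F, multiplicative_char chi &
    chi h = -1 /\ forall x, chi x ^+ 2 = 1.
Proof.
move=> hsq; pose sq := [set (g ^+ 2)%g | g : gT].
have cG (x y : gT) : commute x y by apply: (centsP abG); rewrite inE.
have gsq : group_set sq.
  apply/group_setP; split; first by apply/imsetP; exists 1%g; rewrite ?expg1n.
  move=> _ _ /imsetP[x _ ->] /imsetP[y _ ->].
  by apply/imsetP; exists (x * y)%g; rewrite ?expgMn.
pose S := Group gsq.
have nS x : x \in 'N(S)%g.
  by apply: (subsetP (cent_sub S)); apply/centP => y _; apply: cG.
have setTE : [set: coset_of S] = ([set: gT] / S)%g.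
  apply/setP => y; rewrite !inE; have [x Nx ->] := cosetP y.
  by rewrite mem_quotient ?inE.
have [|||c cP ch] := @multiplicative_char_separates _ F (coset S h).
- by rewrite setTE quotient_abelian.
- rewrite setTE; apply: contraNneq G0 => E.
  by have /dvdnP[k ->] := dvdn_quotient [set: gT] S; rewrite natrM E mulr0.
- apply/eqP => /(coset_idr (nS h)) /imsetP[g _ hg].
  by have := hsq g; rewrite hg eqxx.
have chiP : multiplicative_char (c \o coset S).
  split=> [|x y] /=; first by rewrite morph1 (mchar1 cP).
  by rewrite morphM // (mcharM cP).
have chi2 x : c (coset S x) ^+ 2 = 1.
  rewrite -(mcharX chiP 2 x) /= coset_id ?(mchar1 cP) //.
  by apply/imsetP; exists x.
exists (c \o coset S) => //; split=> //=.
by have /eqP := chi2 h; rewrite sqrf_eq1 (negPf ch) => /eqP.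
Qed.

End Involution.

(** * Gradings *)

Lemma directv_sum_projections (F : fieldType) (V : vectType F) (I : finType)
    (U : I -> {vspace V}) :
    (\sum_i U i = fullv)%VS -> directv (\sum_i U i) ->
  exists pi : I -> 'End(V),
    [/\ forall i v, pi i v \in U i, forall v, \sum_i pi i v = v
      & forall i k v, v \in U i -> pi k v = if k == i then v else 0].
Proof.
move=> full direct; exists (fun i => sumv_pi_for (esym full) i).
have sum v : \sum_i sumv_pi_for (esym full) i v = v.
  by rewrite sumv_pi_sum ?memvf.
split=> // [i v|i k v vi]; first exact: memv_sum_pi.
apply/eqP; rewrite -subr_eq0; apply/eqP.
pose w j := sumv_pi_for (esym full) j v - (if j == i then v else 0).
have /directv_sum_independent/(_ w) w0 := direct.
apply: (w0 _ _ k isT) => [j _|].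
  apply: memvB; first exact: memv_sum_pi.
  by case: eqP => [->|_] //; rewrite mem0v.
rewrite sumrB sum (bigD1 i) //= eqxx big1 ?addr0 ?subrr // => j /negPf ->.
by [].
Qed.

Lemma Z2_gradedP (F : fieldType) (A : superAlgebra F) (U : {vspace A}) :
  Z2_graded_subspace U <-> forall i x, x \in U -> sa_proj A i x \in U.
Proof.
split=> [EU i x|HU].
  rewrite {1}EU => /memv_addP[y]; rewrite memv_cap => /andP[yU y0] [z].
  rewrite memv_cap => /andP[zU z1] ->.
  rewrite linearD /= (sa_proj_hom _ y0) (sa_proj_hom _ z1).
  by case: i; rewrite /= ?add0r ?addr0.
rewrite /Z2_graded_subspace; apply/eqP; rewrite eqEsubv; apply/andP; split.
  apply/subvP => x xU; rewrite -(sa_projD x); apply: memv_add.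
    by rewrite memv_cap sa_proj_mem HU.
  by rewrite memv_cap sa_proj_mem HU.
by apply/subvP => x /memv_addP[y yU [z zU ->]]; apply: memvD;
  [move: yU | move: zU]; rewrite memv_cap => /andP[].
Qed.

Lemma sa_proj_dsum (F : fieldType) (A B : superAlgebra F) i (p : dsum A B) :
  sa_proj (dsum A B) i p = (sa_proj A i p.1, sa_proj B i p.2).
Proof.
case: p => a b /=.
pose p j : dsum A B := (sa_proj A j a, sa_proj B j b).
have pj j : p j \in sa_part (dsum A B) j by rewrite mem_prodv !sa_proj_mem.
have -> : (a, b) = p false + p true :> dsum A B.
  by rewrite -[LHS]/((a, b) : dsum A B) -{1}(sa_projD a) -{1}(sa_projD b).
rewrite linearD /= !(sa_proj_hom _ (pj _)).
by case: i; rewrite /= ?add0r ?addr0.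
Qed.

Lemma sa_mul_suml (F : fieldType) (A : superAlgebra F) (I : finType)
    (E : I -> A) (y : A) : sa_mul (\sum_i E i) y = \sum_i sa_mul (E i) y.
Proof.
elim/big_rec2: _ => [|i a b _ <-]; first by rewrite sa_mul0r.
by rewrite sa_mulDl.
Qed.

Lemma sa_mul_sumr (F : fieldType) (A : superAlgebra F) (I : finType)
    (E : I -> A) (y : A) : sa_mul y (\sum_i E i) = \sum_i sa_mul y (E i).
Proof.
elim/big_rec2: _ => [|i a b _ <-]; first by rewrite sa_mulr0.
by rewrite sa_mulDr.
Qed.

(** Comparing components of degree k in r e = r shows that the degree 1 component e_1 of e is a
    right identity on homogeneous elements, so e = e e_1 = e_1. *)
Lemma grading_one (F : fieldType) (G : finGroupType) (A : superAlgebra F)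
    (Gam : G -> {vspace A}) (e : A) :
    is_grading Gam -> (forall x, sa_mul e x = x) ->
    (forall x, sa_mul x e = x) -> e \in Gam 1%g.
Proof.
case=> full direct _ GM e1 e2.
have [pi [piG pi_sum pi_id]] := directv_sum_projections full direct.
have r1 k r : r \in Gam k -> sa_mul r (pi 1%g e) = r.
  move=> rk; have := e2 r; rewrite -{1}(pi_sum e) sa_mul_sumr.
  move/(congr1 (pi k)); rewrite linear_sum (bigD1 1%g) //= big1 ?addr0.
    have H := GM _ _ _ _ rk (piG 1%g e); rewrite mulg1 in H.
    by rewrite (pi_id _ _ _ H) (pi_id _ _ _ rk) eqxx.
  move=> g g1; rewrite (pi_id _ _ _ (GM _ _ _ _ rk (piG g e))).
  by rewrite -{1}[k]mulg1 (inj_eq (mulgI k)) eq_sym (negPf g1).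
have -> : e = pi 1%g e; last exact: piG.
rewrite -[RHS]e1 -{1 2}(pi_sum e) sa_mul_suml.
by apply: eq_bigr => g _; rewrite (r1 g).
Qed.

(** For x of degree k, the degree gk components of w x and x w are w_g x and x w_g, since G is
    abelian. *)
Lemma central_component (F : fieldType) (G : finGroupType) (A : superAlgebra F)
    (Gam : G -> {vspace A}) (pi : G -> 'End(A)) (w : A) :
    abelian [set: G] -> is_grading Gam ->
    (forall g v, pi g v \in Gam g) -> (forall v, \sum_g pi g v = v) ->
    (forall g k v, v \in Gam g -> pi k v = if k == g then v else 0) ->
    (forall x, sa_mul w x = sa_mul x w) ->
  forall g x, sa_mul (pi g w) x = sa_mul x (pi g w).
Proof.
move=> abG [_ _ _ GM] piG pi_sum pi_id wC g x.
have mulC (y k : G) : (y * k = k * y)%g by apply: (centsP abG); rewrite inE.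
rewrite -(pi_sum x) sa_mul_suml sa_mul_sumr; apply: eq_bigr => k _.
set r := pi k x; have rk : r \in Gam k := piG k x.
have /(congr1 (pi (g * k)%g)) := wC r.
rewrite -{1 2}(pi_sum w) sa_mul_suml sa_mul_sumr !linear_sum /=.
rewrite (bigD1 g) //= [X in _ = X](bigD1 g) //=.
rewrite !big1 ?addr0 => [|l lg|l lg].
- rewrite (pi_id _ _ _ (GM _ _ _ _ (piG g w) rk)) eqxx.
  by rewrite (pi_id _ _ _ (GM _ _ _ _ rk (piG g w))) mulC eqxx.
- rewrite (pi_id _ _ _ (GM _ _ _ _ rk (piG l w))) mulC (inj_eq (mulgI k)).
  by rewrite eq_sym (negPf lg).
- rewrite (pi_id _ _ _ (GM _ _ _ _ (piG l w) rk)) (inj_eq (mulIg k)).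
  by rewrite eq_sym (negPf lg).
Qed.

Lemma direct_sum_ofP (F : fieldType) (V : vectType F) (W : {vspace V})
    (s : seq {vspace V}) :
    (forall i : 'I_(size s), (nth 0%VS s i <= W)%VS) ->
    (forall v, v \in W -> exists2 u : 'I_(size s) -> V,
       forall i, u i \in nth 0%VS s i & v = \sum_i u i) ->
    (forall u : 'I_(size s) -> V, (forall i, u i \in nth 0%VS s i) ->
       \sum_i u i = 0 -> forall i, u i = 0) ->
  direct_sum_of W s.
Proof.
move=> sW Wex s_ind.
have sumE : (\sum_(U <- s) U = \sum_(i < size s) nth 0%VS s i)%VS.
  by rewrite (big_nth 0%VS) big_mkord.
split.
  rewrite sumE; apply/eqP; rewrite eqEsubv; apply/andP; split.
    by apply/subvP => v /Wex[u us ->]; apply/memv_sumP; exists u.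
  by apply/subv_sumP => i _; apply: sW.
rewrite directvE /= sumE (big_nth 0%VS) big_mkord.
have : directv (\sum_(i < size s) nth 0%VS s i).
  by apply/directv_sum_independent => u us u0 i _; apply: s_ind => // j;
    apply: us.
by rewrite directvE.
Qed.

(** * From dag to Types II and III *)

Section SopScale.
Variables (F : fieldType) (A : superAlgebra F).
Implicit Types x y : A.

Lemma sop_mul0r x : sop_mul 0 x = 0.
Proof. by apply: (addIr (sop_mul 0 x)); rewrite -sop_mulDl !add0r. Qed.

Lemma sop_mulr0 x : sop_mul x 0 = 0.
Proof. by apply: (addIr (sop_mul x 0)); rewrite -sop_mulDr !add0r. Qed.

Lemma sop_mulZl a x y : sop_mul (a *: x) y = a *: sop_mul x y.
Proof. by have := sop_mul_linear_l y a x 0; rewrite /= sop_mul0r !addr0. Qed.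

Lemma sop_mulZr a x y : sop_mul x (a *: y) = a *: sop_mul x y.
Proof. by have := sop_mul_linear_r x a y 0; rewrite sop_mulr0 !addr0. Qed.

End SopScale.

Lemma part_preserving_proj (F : fieldType) (A : superAlgebra F) (f : 'End(A)) :
    (forall i x, x \in sa_part A i -> f x \in sa_part A i) ->
  forall i x, f (sa_proj A i x) = sa_proj A i (f x).
Proof.
move=> f_part i x; rewrite -{2}(sa_projD x) !linearD /=.
rewrite !(sa_proj_hom _ (f_part _ _ (sa_proj_mem _ _))).
by case: i; rewrite /= ?add0r ?addr0.
Qed.

(** Such an [f] is the parity operator. As an automorphism, it serves later to prove matrices even
    by showing that they are fixed by it. *)
Lemma parity_mul (F : fieldType) (A : superAlgebra F) (f : 'End(A)) :
    (forall i x, x \in sa_part A i -> f x = (-1) ^+ i *: x) ->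
  forall x y, f (sa_mul x y) = sa_mul (f x) (f y).
Proof.
move=> fE x y.
have hom i k u v : u \in sa_part A i -> v \in sa_part A k ->
    f (sa_mul u v) = sa_mul (f u) (f v).
  move=> ui vk; rewrite (fE _ _ (sa_part_mul ui vk)) (fE _ _ ui) (fE _ _ vk).
  by rewrite sa_mulZl sa_mulZr scalerA signr_addb.
rewrite -(sa_projD x) -(sa_projD y) !sa_mulDl !sa_mulDr !linearD /=.
by rewrite !(hom _ _ _ _ (sa_proj_mem _ _) (sa_proj_mem _ _)) !sa_mulDl
  !sa_mulDr.
Qed.

Lemma sop_mul_evenl (F : fieldType) (A : superAlgebra F) (x y : A) :
  x \in sa_part A false -> sop_mul x y = sa_mul y x.
Proof.
move=> x0; rewrite -(sa_projD y) sop_mulDr sa_mulDl.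
by rewrite !(sop_mulE x0 (sa_proj_mem _ _)) !scale1r.
Qed.

Lemma sop_mul_evenr (F : fieldType) (A : superAlgebra F) (x y : A) :
  y \in sa_part A false -> sop_mul x y = sa_mul y x.
Proof.
move=> y0; rewrite -(sa_projD x) sop_mulDl sa_mulDr.
by rewrite !(sop_mulE (sa_proj_mem _ _) y0) !andbF !scale1r.
Qed.

Section SuperantiautomorphismTheory.
Variables (F : fieldType) (A : superAlgebra F) (dag : 'End(A)).
Hypothesis dagP : superantiautomorphism dag.

Lemma superanti_proj i x : dag (sa_proj A i x) = sa_proj A i (dag x).
Proof. by case: dagP => _ dag_part _; apply: part_preserving_proj. Qed.

(** A superantiautomorphism is a homomorphism from A to [sop A]; in this form the sign rule applies
    to arbitrary elements. *)
Lemma superanti_mul x y : dag (sa_mul x y) = sop_mul (dag x) (dag y).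
Proof.
have [_ dag_part dagM] := dagP.
have hom i j (u v : A) : u \in sa_part A i -> v \in sa_part A j ->
    dag (sa_mul u v) = sop_mul (dag u) (dag v).
  by move=> ui vj; rewrite (sop_mulE (dag_part _ _ ui) (dag_part _ _ vj)) (dagM
    i j).
rewrite -(sa_projD x) -(sa_projD y) !sa_mulDl !sa_mulDr !linearD /=.
rewrite !sop_mulDl !sop_mulDr.
by rewrite !(hom _ _ _ _ (sa_proj_mem _ _) (sa_proj_mem _ _)).
Qed.

Lemma superanti_sop_mul x y : dag (sop_mul x y) = sa_mul (dag x) (dag y).
Proof.
have [_ dag_part dagM] := dagP.
have hom i j (u v : A) : u \in sa_part A i -> v \in sa_part A j ->
    dag (sop_mul u v) = sa_mul (dag u) (dag v).
  move=> ui vj; rewrite (sop_mulE ui vj) linearZ /= (dagM j i) // scalerA.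
  by rewrite [j && i]andbC -signr_addb addbb scale1r.
rewrite -(sa_projD x) -(sa_projD y) !sop_mulDl !sop_mulDr !linearD /=.
rewrite !sa_mulDl !sa_mulDr.
by rewrite !(hom _ _ _ _ (sa_proj_mem _ _) (sa_proj_mem _ _)).
Qed.

(** The factor j on the odd part produces j^2 = -1 on a product of two odd elements, which cancels
    the sign of the super rule and leaves an ordinary antiautomorphism. *)
Lemma superanti_untwist (j : F) : j ^+ 2 = -1 ->
  exists2 f : 'End(A),
    forall i x, x \in sa_part A i -> f x = j ^+ i *: dag x &
    forall x y, f (sa_mul x y) = sa_mul (f y) (f x).
Proof.
move=> j2; have [_ dag_part dagM] := dagP.
pose f : 'End(A) := (dag \o sa_proj A false + j *: (dag \o sa_proj A true))%VF.
have fE i x : x \in sa_part A i -> f x = j ^+ i *: dag x.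
  move=> xi; rewrite add_lfunE scale_lfunE !comp_lfunE !(sa_proj_hom _ xi).
  case: i {xi} => /=; rewrite linear0; first by rewrite add0r expr1.
  by rewrite scaler0 addr0 expr0 scale1r.
exists f => //.
have hom i k u v : u \in sa_part A i -> v \in sa_part A k ->
    f (sa_mul u v) = sa_mul (f v) (f u).
  move=> ui vk.
  rewrite (fE _ _ (sa_part_mul ui vk)) (fE _ _ ui) (fE _ _ vk).
  rewrite (dagM _ _ _ _ ui vk) sa_mulZl sa_mulZr !scalerA; congr (_ *: _).
  case: (i); case: (k); rewrite /= ?expr0 ?expr1 ?mulr1 ?mul1r //.
move=> x y.
rewrite -(sa_projD x) -(sa_projD y) !sa_mulDl !sa_mulDr !linearD /=.
rewrite !(hom _ _ _ _ (sa_proj_mem _ _) (sa_proj_mem _ _)) !sa_mulDl !sa_mulDr.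
by rewrite addrACA.
Qed.

End SuperantiautomorphismTheory.

Section ExchangeGrading.
Variables (F : fieldType) (G : finGroupType) (A : superAlgebra F).
Local Notation pr a b := ((a, b) : dsum A (sop A)).
Variable R : G -> {vspace dsum A (sop A)}.
Hypotheses (gradR : is_grading R) (compatR : grading_compatible (exchange A) R).
Implicit Types (a b c d x y z : A) (g k : G).

Lemma exchange_grading_mul g k a b c d : pr a b \in R g -> pr c d \in R k ->
  pr (sa_mul a c) (sop_mul b d) \in R (g * k)%g.
Proof. by case: gradR => _ _ _ RM H1 H2; apply: (RM _ _ _ _ H1 H2). Qed.

Lemma exchange_grading_swap g a b : pr a b \in R g -> pr b a \in R g.
Proof.
by move=> ab; rewrite -(compatR g) -(exchangeE a b) memv_img.
Qed.

Lemma exchange_grading_proj i g a b :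
  pr a b \in R g -> pr (sa_proj A i a) (sa_proj A i b) \in R g.
Proof.
case: gradR => _ _ RZ _ /((Z2_gradedP _).1 (RZ g) i).
by rewrite sa_proj_dsum.
Qed.

Lemma exchange_gradingD g a b c d : pr a b \in R g -> pr c d \in R g ->
  pr (a + c) (b + d) \in R g.
Proof. exact: memvD. Qed.

Lemma exchange_gradingZ e g a b : pr a b \in R g -> pr (e *: a) (e *:
  b) \in R g.
Proof. exact: memvZ. Qed.

Lemma exchange_gradingB g a b c d : pr a b \in R g -> pr c d \in R g ->
  pr (a - c) (b - d) \in R g.
Proof. exact: memvB. Qed.

(** * The grading of A obtained from dag *)

Section Dagger.
Variables (dag : 'End(A)) (h t : G) (i : F).
Hypotheses (abG : abelian [set: G]) (two_neq0 : 2%:R != 0 :> F).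
Hypotheses (dagP : superantiautomorphism dag).
Hypothesis dag4 : forall x, dag (dag (dag (dag x))) = x.
Hypothesis dagR : forall g a b, pr a b \in R g -> pr (dag a) (dag b) \in R g.
Hypothesis twist : forall g a b, pr a b \in R g -> pr a (- b) \in R (g * h)%g.
Hypotheses (h2 : (h ^+ 2 = 1)%g) (i2 : i ^+ 2 = -1).
(* When dag^2 = 1, the minus parts below vanish and t plays no role.         *)
Hypothesis th : (forall x, dag (dag x) = x) \/ (t ^+ 2 = h)%g.

Let mulGC (x y : G) : (x * y = y * x)%g.
Proof. by apply: (centsP abG); rewrite inE. Qed.

Let dagD x y : dag (x + y) = dag x + dag y. Proof. exact: linearD. Qed.
Let dagN x : dag (- x) = - dag x. Proof. exact: linearN. Qed.
Let dagB x y : dag (x - y) = dag x - dag y. Proof. exact: linearB. Qed.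
Let dagZ (e : F) x : dag (e *: x) = e *: dag x. Proof. exact: linearZ. Qed.
Let dagE := (dagZ, dagB, dagD, dagN).

Let half_double (V : lmodType F) (v : V) : 2%:R^-1 *: (v + v) = v.
Proof. by rewrite -mulr2n -scaler_nat scalerA mulVf // scale1r. Qed.

Let double_eq0 (V : lmodType F) (v : V) : v + v = 0 -> v = 0.
Proof. by move=> vv; rewrite -(half_double v) vv scaler0. Qed.

Let plus_minus x y : dag (dag x) = x -> dag (dag y) = - y -> x + y = 0 ->
  x = 0 /\ y = 0.
Proof.
move=> xp ym /addr0_eq xy; have y0 : y = 0.
  apply: double_eq0; rewrite -{1}[y]opprK -ym -xy !linearN /= xp.
  by rewrite opprK subrr.
by split=> //; rewrite -[x]opprK xy y0 oppr0.
Qed.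

(** These two definitions read the Type III formula backwards: its first two summands place A_g with
    A_+ in R_g, and A_g with A_- in R_(g t^-1). *)
Definition plus_part g : {vspace A} :=
  (linfun (pair_fun dag) @^-1: R g :&: plus_space dag)%VS.
Definition minus_part g : {vspace A} :=
  (linfun (pair_fun (- (i *: dag))) @^-1: R (g * t^-1)%g :&:
    minus_space dag)%VS.

Let plusP g x : reflect (pr x (dag x) \in R g /\ dag (dag x) = x)
  (x \in plus_part g).
Proof.
rewrite memv_cap -memv_preim lfunE; apply: (iffP andP).
  by case=> ? /plus_spaceP.
by case=> ? ?; split=> //; apply/plus_spaceP.
Qed.

Let minusP g x : reflect
  (pr x (- (i *: dag x)) \in R (g * t^-1)%g /\ dag (dag x) = - x)
  (x \in minus_part g).
Proof.
rewrite memv_cap -memv_preim lfunE /= /pair_fun opp_lfunE scale_lfunE.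
apply: (iffP andP).
  by case=> ? /minus_spaceP.
by case=> ? ?; split=> //; apply/minus_spaceP.
Qed.

Definition dagger_grading g : {vspace A} := (plus_part g + minus_part g)%VS.

Let plus_minus_inj x y x' y' : dag (dag x) = x -> dag (dag y) = - y ->
  dag (dag x') = x' -> dag (dag y') = - y' -> x + y = x' + y' ->
  x = x' /\ y = y'.
Proof.
move=> xp ym xp' ym' E; have [| | |x0 y0] := @plus_minus (x - x') (y - y').
- by rewrite !linearB /= xp xp'.
- by rewrite !linearB /= ym ym'.
- by rewrite addrACA -opprD E subrr.
by split; apply/eqP; rewrite -subr_eq0 ?x0 ?y0.
Qed.

Lemma dagger_grading_plus g :
  (dagger_grading g :&: plus_space dag = plus_part g)%VS.
Proof.
apply/vspaceP => x; rewrite memv_cap; apply/andP/idP.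
  case=> /memv_addP[y yP [z /minusP[_ zm] xE]] /plus_spaceP xp.
  have /plusP[_ yp] := yP.
  have [||-> _ //] := @plus_minus_inj x 0 y z xp _ yp zm.
    by rewrite !linear0.
  by rewrite addr0.
move=> xP; have /plusP[_ xp] := xP; split; last exact/plus_spaceP.
by rewrite -[x]addr0 memv_add ?mem0v.
Qed.

Lemma dagger_grading_minus g :
  (dagger_grading g :&: minus_space dag = minus_part g)%VS.
Proof.
apply/vspaceP => x; rewrite memv_cap; apply/andP/idP.
  case=> /memv_addP[y /plusP[_ yp] [z zP xE]] /minus_spaceP xm.
  have /minusP[_ zm] := zP.
  have [||_ ->//] := @plus_minus_inj 0 x y z _ xm yp zm.
    by rewrite !linear0.
  by rewrite add0r.
move=> xP; have /minusP[_ xm] := xP; split; last exact/minus_spaceP.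
by rewrite -[x]add0r memv_add ?mem0v.
Qed.

Let plus_minus_split x : exists y z,
  [/\ dag (dag y) = y, dag (dag z) = - z & x = y + z].
Proof.
exists (2%:R^-1 *: (x + dag (dag x))), (2%:R^-1 *: (x - dag (dag x))).
split.
- by rewrite !linearZ /= [dag (x + _)]linearD /= [dag (_ + _)]linearD /= dag4
    addrC.
- rewrite !linearZ /= [dag (x - _)]linearB /= [dag (_ - _)]linearB /= dag4.
  by rewrite opprB.
- by rewrite -scalerDr addrACA subrr addr0 half_double.
Qed.

(* (a, b) is an eigenvector of (a, b) |-> (dag b, dag a), which preserves the *)
(* components of the grading.                                                *)
Let eigen_components e a b : dag b = e *: a -> dag a = e *: b ->
  exists u v : G -> A, [/\ forall g, pr (u g) (v g) \in R g, \sum_g u g = a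
    & forall g, dag (v g) = e *: u g /\ dag (u g) = e *: v g].
Proof.
move=> db da; have [full direct _ _] := gradR.
have [pi [piR pi_sum pi_id]] := directv_sum_projections full direct.
exists (fun g => (pi g (pr a b)).1), (fun g => (pi g (pr a b)).2).
have fst_sum (E : G -> dsum A (sop A)) : \sum_g (E g).1 = (\sum_g E g).1.
  by elim/big_rec2: _ => // g x y _ ->.
split=> [g||g]; first by rewrite -surjective_pairing piR.
  by rewrite fst_sum pi_sum.
pose kappa (p : dsum A (sop A)) : dsum A (sop A) := pr (dag p.2) (dag p.1).
have kappaR k p : p \in R k -> kappa p \in R k.
  by case: p => x y xy; apply/exchange_grading_swap/dagR.
have kappaD p q : kappa (p + q) = kappa p + kappa q.
  by rewrite /kappa !linearD.
have kappa0 : kappa 0 = 0 by rewrite /kappa !linear0.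
(* Since [kappa] preserves every R_g, it commutes with the projections, so the components of an
   eigenvector are eigenvectors for the same eigenvalue. *)
have : pi g (kappa (pr a b)) = kappa (pi g (pr a b)).
  rewrite -{1}(pi_sum (pr a b)) (big_morph kappa kappaD kappa0) linear_sum /=.
  rewrite (bigD1 g) //= big1 ?addr0 => [|k /negPf kg].
    by rewrite (pi_id _ _ _ (kappaR _ _ (piR g _))) eqxx.
  by rewrite (pi_id _ _ _ (kappaR _ _ (piR k _))) eq_sym kg.
have -> : kappa (pr a b) = e *: pr a b by rewrite /kappa /= db da.
rewrite linearZ /= /kappa; case: (pi g (pr a b)) => x y /= [-> ->].
by [].
Qed.

Let twist2 g a b : pr a b \in R (g * h)%g -> pr a (- b) \in R g.
Proof. by move/twist; rewrite -mulgA -expg2 h2 mulg1. Qed.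

(** Splitting under dag^2 leaves two cases. If dag^2 y = y, the pair (y, dag y) is an eigenvector of
    (a, b) |-> (dag b, dag a) for 1; if dag^2 z = -z, the pair (z, -i dag z) is one for i. The
    components of these pairs have the shape required by the plus and minus parts. *)
Lemma dagger_grading_full : (\sum_g dagger_grading g = fullv)%VS.
Proof.
apply/eqP; rewrite eqEsubv subvf; apply/subvP => x _.
have [y [z [yp zm ->]]] := plus_minus_split x.
apply: memvD.
  have [||u [v [uvR <- uvd]]] := @eigen_components 1 y (dag y);
    rewrite ?scale1r //.
  apply: memv_suml => g _; apply: (subvP (sumv_sup g _ (subvv _))) => //.
  apply: (subvP (addvSl _ _)); have [+ +] := uvd g; rewrite !scale1r => vu uv.
  by apply/plusP; rewrite uv vu uvR.
have [||u [v [uvR <- uvd]]] := @eigen_components i z (- (i *: dag z)).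
- by rewrite linearN linearZ /= zm scalerN opprK.
- by rewrite scalerN scalerA -expr2 i2 scaleN1r opprK.
apply: memv_suml => g _.
apply: (subvP (sumv_sup (g * t)%g _ (subvv _))) => //.
apply: (subvP (addvSr _ _)); have [vu uv] := uvd g.
have vE : v g = - (i *: dag (u g)).
  by rewrite uv scalerA -scaleNr -mulrN mulrN -expr2 i2 opprK scale1r.
by apply/minusP; rewrite mulgK -vE uvR uv linearZ /= vu scalerA -expr2 i2
  scaleN1r.
Qed.

Lemma dagger_grading_independent (u : G -> A) :
  (forall g, u g \in dagger_grading g) -> \sum_g u g = 0 -> forall g, u g = 0.
Proof.
move=> us u0 g; have [_ directR _ _] := gradR.
have /fin_all_exists2[y yP /fin_all_exists2[z zP uE]] :
    forall k, exists2 y, y \in plus_part k & exists2 z,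
      z \in minus_part k & u k = y + z.
  by move=> k; apply/memv_addP/us.
have yp k : dag (dag (y k)) = y k by have /plusP[] := yP k.
have zm k : dag (dag (z k)) = - z k by have /minusP[] := zP k.
have dag_sum (E : G -> A) :
  dag (\sum_k E k) = \sum_k dag (E k) by rewrite linear_sum.
have [|||y0 z0] := @plus_minus (\sum_k y k) (\sum_k z k).
- by rewrite !dag_sum; apply: eq_bigr.
- by rewrite !dag_sum -sumrN; apply: eq_bigr.
- by rewrite -big_split -[RHS]u0; apply: eq_bigr => k _; rewrite uE.
have pair_sum (E E' : G -> A) :
    \sum_k pr (E k) (E' k) = pr (\sum_k E k) (\sum_k E' k).
  by elim/big_rec3: _ => // k a b c _ ->.
move/directv_sum_independent: directR => indep.
have yg : y g = 0.
  suff : pr (y g) (dag (y g)) = 0 by case.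
  apply: (indep (fun k => pr (y k) (dag (y k))) _ _ g isT) => [k _|].
    by have /plusP[] := yP k.
  by rewrite pair_sum -dag_sum y0 linear0.
(* The index is shifted by t because the pair attached to the minus part of degree k t lies in
   R_k. *)
pose w k := pr (z (k * t)%g) (- (i *: dag (z (k * t)%g))).
suff : w (g * t^-1)%g = 0 by case; rewrite mulgKV uE yg add0r.
apply: (indep w _ _ (g * t^-1)%g isT) => [k _|].
  by have /minusP[] := zP (k * t)%g; rewrite mulgK.
rewrite pair_sum sumrN -scaler_sumr -dag_sum.
have <- : \sum_k z k = \sum_k z (k * t)%g by rewrite (reindex_inj (mulIg t)).
by rewrite z0 linear0 scaler0 oppr0.
Qed.

Lemma dagger_is_grading : is_grading dagger_grading.
Proof.
split; first exact: dagger_grading_full.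
- by apply/directv_sum_independent => u us u0 g _;
    apply: dagger_grading_independent u0 g => k; apply: us.
- move=> g; apply/Z2_gradedP =>
    j x /memv_addP[y /plusP[yR yp] [z /minusP[zR zm] ->]].
  rewrite linearD /=; apply: memv_add.
    apply/plusP; rewrite !(superanti_proj dagP) yp; split=> //.
    exact: exchange_grading_proj.
  apply/minusP; rewrite !(superanti_proj dagP) zm linearN; split=> //.
  by have := exchange_grading_proj j zR; rewrite linearN linearZ.
move=> g k x y /memv_addP[a /plusP[aR ap] [b /minusP[bR bm] ->]].
move=> /memv_addP[c /plusP[cR cp] [d /minusP[dR dm] ->]].
have ddM u v : dag (dag (sa_mul u v)) = sa_mul (dag (dag u)) (dag (dag v)).
  by rewrite (superanti_mul dagP) (superanti_sop_mul dagP).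
rewrite sa_mulDl !sa_mulDr [sa_mul b c + _]addrC addrACA; apply: memv_add.
  apply: memvD; apply/plusP; rewrite ddM.
    by rewrite ap cp (superanti_mul dagP); split=> //;
      apply: exchange_grading_mul.
  rewrite bm dm -scaleN1r -[- d]scaleN1r sa_mulZl sa_mulZr scalerA mulrNN mulr1
    scale1r.
  split=> //; rewrite (superanti_mul dagP).
  (* The product (b, -i dag b)(d, -i dag d) is (bd, -dag(bd)), of degree g k t^-2; the twist by h =
     t^2 corrects both the sign and the degree. If dag^2 = 1 then b = 0. *)
  case: th => [dd|tt].
    have b0 : b = 0 by apply: double_eq0; rewrite -{1}(dd b) bm addNr.
    by rewrite b0 sa_mul0r linear0 sop_mul0r; apply: mem0v.
  have := exchange_grading_mul bR dR;
    rewrite -!scaleNr sop_mulZl sop_mulZr scalerA.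
  rewrite mulrNN -expr2 i2 scaleN1r => /twist; rewrite opprK.
  suff -> : (g * t^-1 * (k * t^-1) * h = g * k)%g by [].
  by rewrite -tt expg2 !mulgA mulgKV -mulgA (mulGC k) mulgA mulgKV.
apply: memvD; apply/minusP; rewrite ddM.
  rewrite ap dm -[- d]scaleN1r sa_mulZr scaleN1r (superanti_mul dagP);
    split=> //.
  have := exchange_grading_mul aR dR.
  by rewrite -!scaleNr sop_mulZr mulgA.
rewrite bm cp -[- b]scaleN1r sa_mulZl scaleN1r (superanti_mul dagP); split=> //.
have := exchange_grading_mul bR cR.
by rewrite -!scaleNr sop_mulZl -!mulgA (mulGC t^-1).
Qed.

Lemma dagger_grading_compatible : grading_compatible dag dagger_grading.
Proof.
have dagU g : (dag @: dagger_grading g <= dagger_grading g)%VS.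
  apply/subvP => _ /memv_imgP[x /memv_addP[y /plusP[yR yp] [z /minusP[zR zm]
    ->]] ->].
  rewrite linearD /=; apply: memv_add.
    by apply/plusP; split; [apply: dagR | rewrite yp].
  apply/minusP; split; last by rewrite zm linearN.
  by have := dagR zR; rewrite linearN linearZ.
(* The reverse inclusion holds because the inverse of dag is dag^3. *)
move=> g; apply/eqP; rewrite eqEsubv dagU; apply/subvP => x xg.
rewrite -[x]dag4; apply/memv_img.
by do 3![apply: (subvP (dagU g)); apply: memv_img].
Qed.

(** A pair in R_g is first split by the eigenvalues of dag^2, then by those of (a, b) |-> (dag b,
    dag a): 1 and -1 on the plus half give x1 and x3, i and -i on the minus half give x2 and x4. The
    twist moves the pairs of x3 and x4 to degree gh with the sign used in the parts. *)
Lemma exchange_grading_decomposition g a b : pr a b \in R g ->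
  exists x1 x2 x3 x4,
    [/\ x1 \in plus_part g, x2 \in minus_part (g * t)%g,
        x3 \in plus_part (g * h)%g, x4 \in minus_part (g * h * t)%g
      & pr a b = pr (x1 + x2 + x3 + x4)
          (dag x1 - i *: dag x2 - dag x3 + i *: dag x4)].
Proof.
move=> ab; have abd := dagR (dagR ab); have ba := exchange_grading_swap ab.
have bad := exchange_grading_swap abd.
pose a1 := 2%:R^-1 *: (a + dag (dag a));
  pose b1 := 2%:R^-1 *: (b + dag (dag b)).
pose a2 := 2%:R^-1 *: (a - dag (dag a));
  pose b2 := 2%:R^-1 *: (b - dag (dag b)).
have ab1 : pr a1 b1 \in R g by apply: exchange_gradingZ;
  apply: exchange_gradingD.
have ab2 : pr a2 b2 \in R g by apply: exchange_gradingZ;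
  apply: exchange_gradingB.
have plus_half x : dag (dag (2%:R^-1 *: (x + dag (dag x)))) = 2%:R^-1 *:
  (x + dag (dag x)).
  by rewrite !linearZ /= [dag (x + _)]linearD /= [dag (_ + _)]linearD /= dag4
    addrC.
have minus_half x : dag (dag (2%:R^-1 *: (x - dag (dag x)))) = - (2%:R^-1 *:
  (x - dag (dag x))).
  rewrite !linearZ /= [dag (x - _)]linearB /= [dag (_ - _)]linearB /= dag4.
  by rewrite opprB.
have [a1p b1p a2m b2m] : [/\ dag (dag a1) = a1, dag (dag b1) = b1,
   dag (dag a2) = - a2 & dag (dag b2) = - b2].
  by rewrite /a1 /b1 /a2 /b2 !plus_half !minus_half.
have aE : a = a1 + a2 by rewrite -scalerDr addrACA subrr addr0 half_double.
have bE : b = b1 + b2 by rewrite -scalerDr addrACA subrr addr0 half_double.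
move: a1 b1 a2 b2 ab1 ab2 a1p b1p a2m b2m aE bE => a1 b1 a2 b2.
move=> ab1 ab2 a1p b1p a2m b2m -> -> {plus_half minus_half ba bad abd ab a b}.
pose x1 := 2%:R^-1 *: (a1 + dag b1); pose x3 := 2%:R^-1 *: (a1 - dag b1).
pose x2 := 2%:R^-1 *: (a2 - i *: dag b2);
  pose x4 := 2%:R^-1 *: (a2 + i *: dag b2).
have dx1 : dag x1 = 2%:R^-1 *: (b1 + dag a1) by rewrite !dagE b1p addrC.
have dx3 : - dag x3 = 2%:R^-1 *: (b1 - dag a1).
  by rewrite !dagE b1p -scalerN opprB.
have dx2 : - (i *: dag x2) = 2%:R^-1 *: (b2 - i *: dag a2).
  rewrite !dagE b2m scalerA mulrC -scalerA -scalerN; congr (_ *: _).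
  by rewrite scalerN opprK scalerDr scalerA -expr2 i2 scaleN1r opprD opprK
    addrC.
have dx4 : i *: dag x4 = 2%:R^-1 *: (b2 + i *: dag a2).
  rewrite !dagE b2m scalerA mulrC -scalerA; congr (_ *: _).
  by rewrite scalerDr !scalerN scalerA -expr2 i2 scaleN1r opprK addrC.
have ddx : [/\ dag (dag x1) = x1, dag (dag x2) = - x2, dag (dag x3) = x3
            & dag (dag x4) = - x4].
  rewrite !dagE a1p b1p a2m b2m !dagE; split=> //.
    by rewrite scalerN opprK -scalerN opprB addrC.
  by rewrite scalerN -opprD scalerN.
have [x1p x2m x3p x4m] := ddx.
have ba1 := exchange_grading_swap (dagR ab1).
have ba2 := exchange_grading_swap (dagR ab2).
exists x1, x2, x3, x4; split.
- apply/plusP; rewrite dx1; split; last by rewrite -dx1 x1p.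
  by apply: exchange_gradingZ; apply: exchange_gradingD.
- apply/minusP; rewrite mulgK dx2; split=> //.
  by apply: exchange_gradingZ; apply: exchange_gradingB => //;
    apply: exchange_gradingZ.
- apply/plusP; split=> //; rewrite -[dag x3]opprK; apply: twist; rewrite dx3.
  by apply: exchange_gradingZ; apply: exchange_gradingB.
- apply/minusP; rewrite mulgK; split=> //; apply: twist; rewrite dx4.
  by apply: exchange_gradingZ; apply: exchange_gradingD => //;
    apply: exchange_gradingZ.
have four y z u v : 2%:R^-1 *: (y + z) + 2%:R^-1 *: (u - v)
    + 2%:R^-1 *: (y - z) + 2%:R^-1 *: (u + v) = y + u :> A.
  rewrite -!scalerDr -addrA addrACA [y + z + _]addrACA [u - v + _]addrACA.
  by rewrite subrr addNr !addr0 addrACA half_double.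
by rewrite dx1 dx2 dx3 dx4 !four.
Qed.
Let plus_part_sub g x : x \in plus_part g -> pr x (dag x) \in R g.
Proof. by case/plusP. Qed.

Let plus_part_twist g x : x \in plus_part (g * h)%g -> pr x (- dag x) \in R g.
Proof. by case/plusP => xR _; apply: twist2. Qed.

Let minus_part_sub g x : x \in minus_part (g * t)%g ->
  pr x (- (i *: dag x)) \in R g.
Proof. by case/minusP; rewrite mulgK. Qed.

Let minus_part_twist g x : x \in minus_part (g * h * t)%g ->
  pr x (i *: dag x) \in R g.
Proof. by case/minusP; rewrite mulgK => /twist2; rewrite opprK. Qed.

(** Separating both equations by the eigenvalues of dag^2 gives x1 + x3 = 0 and dag(x1 - x3) = 0,
    and likewise for x2 and x4; dag is injective and 2 is invertible. *)
Let graphs_independent g1 g2 g3 g4 x1 x2 x3 x4 :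
    x1 \in plus_part g1 -> x2 \in minus_part g2 -> x3 \in plus_part g3 ->
    x4 \in minus_part g4 -> x1 + x2 + x3 + x4 = 0 ->
    dag x1 - i *: dag x2 - dag x3 + i *: dag x4 = 0 ->
  [/\ x1 = 0, x2 = 0, x3 = 0 & x4 = 0].
Proof.
move=> /plusP[_ p1] /minusP[_ m2] /plusP[_ p3] /minusP[_ m4] s0 d0.
have [|||e13 e24] := @plus_minus (x1 + x3) (x2 + x4).
- by rewrite !dagE p1 p3.
- by rewrite !dagE m2 m4 opprD.
- by rewrite addrACA addrA.
have dp : dag (dag (x1 - x3)) = x1 - x3 by rewrite !dagB p1 p3.
have dm : dag (dag (x2 - x4)) = - (x2 - x4) by rewrite !dagB m2 m4 opprD.
have [|||f13 /eqP] := @plus_minus (dag (x1 - x3)) (- (i *: dag (x2 - x4))).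
- by rewrite dp.
- by rewrite !(dagN, dagZ) dm dagN scalerN.
- by rewrite !dagB scalerBr opprB -[RHS]d0 -!addrA; congr (_ + _);
     rewrite [RHS]addrCA; congr (_ + _); rewrite addrC.
rewrite oppr_eq0 scaler_eq0 => /orP[/eqP i0|/eqP f24].
  by have /eqP := i2; rewrite i0 expr0n eq_sym oppr_eq0 oner_eq0.
have g13 : x1 - x3 = 0 by rewrite -dp f13 linear0.
have g24 : x2 - x4 = 0 by apply: oppr_inj; rewrite -dm f24 linear0 oppr0.
have sum_diff0 y z : y + z = 0 -> y - z = 0 -> y = 0 /\ z = 0.
  move=> s0' /eqP; rewrite subr_eq0 => /eqP yz; move: s0'; rewrite yz.
  by move/double_eq0.
by have [-> ->] := sum_diff0 _ _ e13 g13; have [-> ->] := sum_diff0 _ _ e24 g24.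
Qed.

Lemma dagger_type_II :
  #[h]%g = 2%N -> (forall x, dag (dag x) = x) -> type_II R.
Proof.
move=> oh dd; have minus0 g x : x \in minus_part g -> x = 0.
  by case/minusP=> _; rewrite dd => xN; apply: double_eq0; rewrite {1}xN addNr.
have gradE g : dagger_grading g = plus_part g.
  apply/vspaceP => x; apply/memv_addP/idP => [[y yP [z /minus0-> ->]]|xP].
    by rewrite addr0.
  by exists x => //; exists 0; rewrite ?mem0v ?addr0.
exists dag, dagger_grading, h; split=> // [||g].
- exact: dagger_is_grading.
- exact: dagger_grading_compatible.
rewrite !gradE; apply: direct_sum_ofP => /=.
- case=> -[|[|//]] ? /=; apply/subvP => _ /graphvP[x xP ->].
    exact: plus_part_sub.
  by rewrite opp_lfunE; apply: plus_part_twist.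
- case=> a b /exchange_grading_decomposition[x1 [x2 [x3 [x4]]]].
  case=> x1P /minus0-> x3P /minus0-> ->.
  exists (fun j => if j == ord0 then pr x1 (dag x1) else pr x3 (- dag x3)).
    case=> -[|[|//]] ? /=; apply/graphvP; first by exists x1.
    by exists x3; rewrite ?opp_lfunE.
  by rewrite !big_ord_recl big_ord0 /= !linear0 ?scaler0 !addr0 ?subr0.
move=> u uP u0.
have /graphvP[x1 x1P u1E] := uP ord0.
have /graphvP[x3 x3P u3E] := uP (lift ord0 ord0).
move: u0; rewrite !big_ord_recl big_ord0 addr0 u1E u3E opp_lfunE => -[s0 d0].
have z0 : 0 \in minus_part g by rewrite mem0v.
have [||e1 _ e3 _] := @graphs_independent _ _ _ _ x1 0 x3 0 x1P z0 x3P z0.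
- by rewrite !addr0.
- by rewrite linear0 scaler0 subr0 addr0.
move=> j; have [->|->] : j = ord0 \/ j = lift ord0 ord0.
- by case: j => -[|[|//]] ?; [left|right]; apply: val_inj.
- by rewrite u1E e1 linear0.
- by rewrite u3E e3 linear0.
Qed.

Lemma dagger_type_III : #[t]%g = 4%N -> (t ^+ 2 = h)%g ->
  ~ (forall x, dag (dag x) = x) -> type_III R.
Proof.
move=> ot t2 ndd; exists dag, dagger_grading, t, i; split=> //.
(* The exponents 1 and 2 contradict dag^2 <> 1, and dag^3 = 1 would give dag = dag^4 = 1. *)
- split=> //; split=> // -[|[|[|[|//]]]] // _ /= dl; apply: ndd => x.
  + by rewrite !dl.
  + have d1 y : dag y = y by rewrite -[LHS]dl dag4.
    by rewrite !d1.
- exact: dagger_is_grading.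
- exact: dagger_grading_compatible.
move=> g; have t3 : (g * t ^+ 3 = g * h * t)%g by rewrite expgSr t2 mulgA.
rewrite t2 t3 !dagger_grading_plus !dagger_grading_minus.
apply: direct_sum_ofP => /=.
- case=> -[|[|[|[|//]]]] ? /=; apply/subvP => _ /graphvP[x xP ->];
    rewrite ?opp_lfunE ?scale_lfunE.
  + exact: plus_part_sub.
  + exact: minus_part_sub.
  + exact: plus_part_twist.
  + exact: minus_part_twist.
- case=> a b /exchange_grading_decomposition[x1 [x2 [x3 [x4]]]].
  case=> x1P x2P x3P x4P ->.
  exists (fun j => nth 0 [:: pr x1 (dag x1); pr x2 (- (i *: dag x2));
    pr x3 (- dag x3); pr x4 (i *: dag x4)] j).
    case=> -[|[|[|[|//]]]] ? /=; apply/graphvP;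
      [exists x1 | exists x2 | exists x3 | exists x4];
      by rewrite ?opp_lfunE ?scale_lfunE.
  by rewrite !big_ord_recl big_ord0 /= !addrA addr0.
move=> u uP u0.
pose o2 : 'I_4 := @Ordinal 4 2 isT; pose o3 : 'I_4 := @Ordinal 4 3 isT.
pose o1 : 'I_4 := @Ordinal 4 1 isT.
have /graphvP[x1 x1P u1E] := uP ord0.
have /graphvP[x2 x2P u2E] := uP o1.
have /graphvP[x3 x3P u3E] := uP o2.
have /graphvP[x4 x4P u4E] := uP o3.
have : u ord0 + u o1 + u o2 + u o3 = 0.
  rewrite -[RHS]u0 !big_ord_recl big_ord0 addr0 !addrA.
  by congr (_ + u _ + u _ + u _); apply: val_inj.
rewrite u1E u2E u3E u4E ?opp_lfunE ?scale_lfunE => -[s0 d0].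
have [e1 e2 e3 e4] := graphs_independent x1P x2P x3P x4P s0 d0.
have [uu1 uu2 uu3 uu4] : [/\ u ord0 = 0, u o1 = 0, u o2 = 0 & u o3 = 0].
  by rewrite u1E u2E u3E u4E e1 e2 e3 e4 !linear0.
case=> -[|[|[|[|//]]]] lt4;
  [rewrite -uu1 | rewrite -uu2 | rewrite -uu3 | rewrite -uu4];
  by congr (u _); apply: val_inj.
Qed.

End Dagger.
End ExchangeGrading.

(** * The action of the characters *)

Section CharacterAction.
Variables (F : fieldType) (G : finGroupType) (A : superAlgebra F).
Local Notation pr a b := ((a, b) : dsum A (sop A)).
Variable R : G -> {vspace dsum A (sop A)}.
Hypotheses (gradR : is_grading R) (compatR : grading_compatible (exchange A) R).
Implicit Types (a b x y z : A) (g k : G) (chi : G -> F) (phi : 'End(A)).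

(** The exchange fixes (x, x) and preserves each R_g, so it fixes the homogeneous components of (x,
    x), which are therefore diagonal. *)
Lemma diagonal_components x : exists2 u : G -> A,
  forall g, pr (u g) (u g) \in R g & \sum_g u g = x.
Proof.
have [full direct _ _] := gradR.
have [pi [piR pi_sum pi_id]] := directv_sum_projections full direct.
exists (fun g => (pi g (pr x x)).1) => [g|]; last first.
  rewrite -[RHS]/(pr x x).1 -[in RHS](pi_sum (pr x x)).
  by elim/big_rec2: _ => // g y p _ ->.
suff {2}-> : (pi g (pr x x)).1 =
  (pi g (pr x x)).2 by rewrite -surjective_pairing.
have : pi g (exchange A (pr x x)) = exchange A (pi g (pr x x)).
  rewrite -{1}(pi_sum (pr x x)) !linear_sum (bigD1 g) //= big1 ?addr0.
    rewrite (pi_id g) ?eqxx // -(compatR g); exact: memv_img.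
  move=> k /negPf kg; rewrite (pi_id k) 1?eq_sym ?kg // -(compatR k).
  exact: memv_img.
rewrite exchangeE; case: (pi g (pr x x)) => y z /=.
by rewrite exchangeE => -[].
Qed.

Lemma homogeneous_ind (P : A -> Prop) :
    P 0 -> (forall x y, P x -> P y -> P (x + y)) ->
    (forall g i x, pr x x \in R g -> x \in sa_part A i -> P x) ->
  forall x, P x.
Proof.
move=> P0 PD Phom x; have [u uR <-] := diagonal_components x.
elim/big_ind: _ => // g _; rewrite -(sa_projD (u g)).
by apply: (PD); apply:
  Phom (exchange_grading_proj gradR _ (uR g)) (sa_proj_mem _ _).
Qed.

Lemma diagonal_independent (u : G -> A) :
  (forall g, pr (u g) (u g) \in R g) -> \sum_g u g = 0 -> forall g, u g = 0.
Proof.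
case: gradR => _ direct _ _ uR u0 g.
have /directv_sum_independent/(_ (fun k => pr (u k) (u k))) indep := direct.
have [] // : pr (u g) (u g) = 0; apply: (indep _ _ g isT) => // {g}.
suff -> : \sum_g pr (u g) (u g) = pr (\sum_g u g) (\sum_g u g) by rewrite u0.
by elim/big_rec2: _ => // g x y _ ->.
Qed.

(** The spaces {x | (x, x) in R_g} decompose A as a vector space, so [phi] is determined by [chi].
    In general they do not form an algebra grading, and [phi] may reverse products. *)
Definition char_action chi phi : Prop :=
  forall g x, pr x x \in R g -> phi x = chi g *: x.

Lemma char_action_exists chi : exists phi, char_action chi phi.
Proof.
have [full direct _ _] := gradR.
have [pi [_ _ pi_id]] := directv_sum_projections full direct.
exists (\sum_g chi g *: (linfun (@fst A A) \o pi g \o linfun (pair_fun \1)))%VF.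
move=> g x xR; rewrite sum_lfunE (bigD1 g) //= big1 ?addr0 => [|k /negPf kg];
  rewrite scale_lfunE !comp_lfunE !lfunE /= /pair_fun id_lfunE (pi_id _ _ _ xR).
  by rewrite eqxx.
by rewrite kg scaler0.
Qed.

Lemma eigen_iter phi (k : nat) :
  (forall g i x, pr x x \in R g -> x \in sa_part A i ->
     exists2 e : F, e ^+ k = 1 & phi x = e *: x) ->
  forall x, iter k phi x = x.
Proof.
move=> phiE; apply: homogeneous_ind => [|x y IHx IHy|g i x xR xi].
- by elim: k {phiE} => //= k ->; rewrite linear0.
- rewrite -{2}IHx -{2}IHy; elim: k {phiE IHx IHy} => //= k ->.
  by rewrite linearD.
have [e ek ex] := phiE g i x xR xi.
rewrite -[RHS]scale1r -ek; elim: k {ek phiE} => [|k IH] /=.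
  by rewrite expr0 scale1r.
by rewrite IH linearZ /= ex scalerA exprSr.
Qed.

Lemma char_action_iter chi phi (k : nat) :
  char_action chi phi -> (forall g, chi g ^+ k = 1) ->
  forall x, iter k phi x = x.
Proof.
by move=> phiE chik; apply: eigen_iter => g i x xR _; exists (chi g);
  rewrite ?(phiE g).
Qed.

Lemma char_action_comm chi1 chi2 phi1 phi2 :
  char_action chi1 phi1 -> char_action chi2 phi2 ->
  forall x, phi1 (phi2 x) = phi2 (phi1 x).
Proof.
move=> E1 E2; apply: homogeneous_ind => [|x y IHx IHy|g i x xR _].
- by rewrite !linear0.
- by rewrite !linearD /= IHx IHy.
by rewrite (E2 _ _ xR) (E1 _ _ xR) !linearZ /= (E1 _ _ xR) (E2 _ _ xR) !scalerA
  mulrC.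
Qed.

Lemma char_action_part chi phi i x :
  char_action chi phi -> x \in sa_part A i -> phi x \in sa_part A i.
Proof.
move=> phiE /sa_proj_id <-; move: x.
apply: homogeneous_ind => [|x y IHx IHy|g j x xR xj].
- by rewrite !linear0 mem0v.
- by rewrite !linearD memvD.
rewrite (sa_proj_hom i xj); case: eqP => [->|_]; last by rewrite linear0 mem0v.
by rewrite (phiE g) // memvZ.
Qed.

Variable h : G.
Hypotheses (two_neq0 : 2%:R != 0 :> F) (h2 : (h ^+ 2 = 1)%g).
Hypothesis twist : forall g a b, pr a b \in R g -> pr a (- b) \in R (g * h)%g.

Section ActionOnPairs.
Variables (chi : G -> F) (phi : 'End(A)).
Hypotheses (chiP : multiplicative_char chi) (phiE : char_action chi phi).

Let half_scale (e : F) x : 2%:R^-1 *: (e *: (x + x)) = e *: x.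
Proof.
by rewrite -mulr2n -scaler_nat !scalerA mulrAC mulVf // mul1r.
Qed.

(** Twice a is (a + b) + (a - b), where (a + b, a + b) lies in R_g and, after the twist, (a - b, a -
    b) lies in R_(gh). *)
Let action_pair g a b : pr a b \in R g ->
  phi a = 2%:R^-1 *: (chi g *: (a + b) + chi (g * h)%g *: (a - b)).
Proof.
move=> ab; have ba := exchange_grading_swap compatR ab.
have sumR : pr (a + b) (a + b) \in R g.
  by have := exchange_gradingD ab ba; rewrite [b + a]addrC.
have diffR : pr (a - b) (a - b) \in R (g * h)%g.
  by have := twist (exchange_gradingB ab ba); rewrite opprB.
rewrite -(phiE sumR) -(phiE diffR) -linearD addrACA subrr addr0 -mulr2n.
by rewrite -scaler_nat linearZ /= scalerA mulVf // scale1r.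
Qed.

Lemma even_action_pair g a b : chi h = 1 -> pr a b \in R g -> phi a = chi g *:
  a.
Proof.
move=> chih /action_pair->; rewrite (mcharM chiP) chih mulr1 -scalerDr addrACA.
by rewrite subrr addr0 half_scale.
Qed.

Lemma odd_action_pair g a b : chi h = -1 -> pr a b \in R g -> phi a = chi g *:
  b.
Proof.
move=> chih /action_pair->; rewrite (mcharM chiP) chih mulrN1 scaleNr -scalerBr.
by rewrite opprB [a + b]addrC addrACA subrr addr0 half_scale.
Qed.

Lemma even_action_mul x y : chi h = 1 ->
  phi (sa_mul x y) = sa_mul (phi x) (phi y).
Proof.
move=> chih; move: x; apply: homogeneous_ind => [|x x' IHx IHx'|g i x xR xi].
- by rewrite sa_mul0r !linear0 sa_mul0r.
- by rewrite sa_mulDl !linearD /= IHx IHx' sa_mulDl.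
move: y; apply: homogeneous_ind => [|y y' IHy IHy'|k j y yR yj].
- by rewrite sa_mulr0 !linear0 sa_mulr0.
- by rewrite sa_mulDr !linearD /= IHy IHy' sa_mulDr.
rewrite (even_action_pair chih (exchange_grading_mul gradR xR yR)).
by rewrite (phiE xR) (phiE yR) sa_mulZl sa_mulZr scalerA (mcharM chiP).
Qed.

(** When chi(h) = -1, [phi] sends the first coordinate of a pair in R_g to chi(g) times the second.
    Applied to (x, x)(y, y), whose second coordinate is the product in [sop A], this reverses the
    factors with the super sign. *)
Lemma odd_action_mul i j x y : chi h = -1 ->
  x \in sa_part A i -> y \in sa_part A j ->
  phi (sa_mul x y) = (-1) ^+ (i && j) *: sa_mul (phi y) (phi x).
Proof.
move=> chih /sa_proj_id <- /sa_proj_id <-; move: x.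
apply: homogeneous_ind => [|x x' IHx IHx'|g i' x xR xi'].
- by rewrite !(linear0, sa_mul0r, sa_mulr0) ?scaler0.
- by rewrite !linearD /= sa_mulDl sa_mulDr linearD scalerDr /= IHx IHx'.
rewrite (sa_proj_hom i xi'); case: eqP => [->|_]; last first.
  by rewrite !(linear0, sa_mul0r, sa_mulr0) ?scaler0.
move: y; apply: homogeneous_ind => [|y y' IHy IHy'|k j' y yR yj'].
- by rewrite !(linear0, sa_mul0r, sa_mulr0) ?scaler0.
- by rewrite !linearD /= sa_mulDl sa_mulDr linearD scalerDr /= IHy IHy'.
rewrite (sa_proj_hom j yj'); case: eqP => [->|_]; last first.
  by rewrite !(linear0, sa_mul0r, sa_mulr0) ?scaler0.
rewrite (odd_action_pair chih (exchange_grading_mul gradR xR yR)).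
rewrite (sop_mulE xi' yj') (phiE xR) (phiE yR) sa_mulZl sa_mulZr !scalerA.
by rewrite (mcharM chiP) mulrC [chi k * _]mulrC !mulrA.
Qed.

Lemma odd_action_superanti : chi h = -1 -> superantiautomorphism phi.
Proof.
move=> chih; split.
(* The values of [chi] are roots of unity of exponent |G|, so phi^(|G|-1) is the inverse of
   [phi]. *)
- exists (iter #|[set: G]|.-1 phi) => x;
    have := char_action_iter phiE (mchar_expn chiP) x;
    have /prednK <- : (0 < #|[set: G]|)%N by rewrite cardsT; apply/card_gt0P;
      exists 1%g.
  + by rewrite iterSr.
  + by rewrite iterS.
- by move=> i x; apply: char_action_part phiE.
- by move=> i j x y; apply: odd_action_mul.
Qed.

End ActionOnPairs.
End CharacterAction.

(** * Recovering the components of R from the characters *)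

Section CharacterSeparation.
Variables (F : closedFieldType) (G : finGroupType) (A : superAlgebra F).
Local Notation pr a b := ((a, b) : dsum A (sop A)).
Variable R : G -> {vspace dsum A (sop A)}.
Hypotheses (gradR : is_grading R) (compatR : grading_compatible (exchange A) R).
Hypotheses (abG : abelian [set: G]) (G0 : #|[set: G]|%:R != 0 :> F).
Variable h : G.
Hypotheses (two_neq0 : 2%:R != 0 :> F) (h2 : (h ^+ 2 = 1)%g).
Hypothesis twist : forall g a b, pr a b \in R g -> pr a (- b) \in R (g * h)%g.

Lemma action_comm_preserves (f : 'End(A)) :
    (forall chi phi, multiplicative_char chi -> char_action R chi phi ->
       forall x, f (phi x) = phi (f x)) ->
  forall g a b, pr a b \in R g -> pr (f a) (f b) \in R g.
Proof.
move=> fC.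
have fdiag g x : pr x x \in R g -> pr (f x) (f x) \in R g.
  move=> xR; have [u uR ux] := diagonal_components gradR compatR (f x).
  suff -> : f x = u g by [].
  rewrite -ux (bigD1 g) //= big1 ?addr0 // => k kg.
  have kg1 : (k * g^-1 != 1)%g by rewrite -eq_mulgV1.
  have [chi chiP chi_kg] := multiplicative_char_separates abG G0 kg1.
  have [phi phiE] := char_action_exists gradR chi.
  (* Applying [f] to the eigenvector x shows that [f x] has eigenvalue chi(g). As chi(k) differs
     from chi(g), independence kills the component of [f x] of degree k. *)
  have sum0 : \sum_l (chi l - chi g) *: u l = 0.
    have := fC chi phi chiP phiE x; rewrite (phiE _ _ xR) linearZ /= -ux.
    rewrite !linear_sum /= => E.
    under eq_bigr do rewrite scalerBl; rewrite sumrB E -sumrB big1 // => l _.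
    by rewrite (phiE _ _ (uR l)) subrr.
  have /(_ k)/eqP := diagonal_independent gradR (fun l =>
    exchange_gradingZ (chi l - chi g) (uR l)) sum0.
  rewrite scaler_eq0 subr_eq0 => /orP[/eqP E|/eqP //].
  case/eqP: chi_kg; rewrite (mcharM chiP) E -(mcharM chiP) mulgV.
  exact: mchar1.
move=> g a b ab; have ba := exchange_grading_swap compatR ab.
have sumR : pr (a + b) (a + b) \in R g.
  by have := exchange_gradingD ab ba; rewrite [b + a]addrC.
have diffR : pr (a - b) (a - b) \in R (g * h)%g.
  by have := twist (exchange_gradingB ab ba); rewrite opprB.
have fsum := fdiag _ _ sumR.
have fdiff := twist (fdiag _ _ diffR); rewrite -mulgA -expg2 h2 mulg1 in fdiff.
have := exchange_gradingZ 2%:R^-1 (exchange_gradingD fsum fdiff).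
have -> : f (a + b) + f (a - b) = f a + f a.
  by rewrite linearD linearB addrACA subrr addr0.
have -> : f (a + b) - f (a - b) = f b + f b.
  by rewrite linearD linearB opprB [f a + _]addrC addrACA subrr addr0.
by rewrite -!mulr2n -!scaler_nat !scalerA mulVf // !scale1r.
Qed.

(* Two characters equal to -1 at h differ by a character equal to 1 at h.     *)
Lemma odd_even_comm_preserves chi0 phi0 (f : 'End(A)) :
    multiplicative_char chi0 -> chi0 h = -1 -> char_action R chi0 phi0 ->
    (forall x, f (phi0 x) = phi0 (f x)) ->
    (forall chi phi, multiplicative_char chi -> chi h = 1 ->
       char_action R chi phi -> forall x, f (phi x) = phi (f x)) ->
  forall g a b, pr a b \in R g -> pr (f a) (f b) \in R g.
Proof.
move=> chi0P chi0h phi0E fphi0 feven; apply: action_comm_preserves.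
move=> chi phi chiP phiE.
have /eqP : chi h ^+ 2 = 1 by rewrite -(mcharX chiP) h2 (mchar1 chiP).
rewrite sqrf_eq1 => /orP[] /eqP chih; first exact: feven chiP chih phiE.
have [psi psiE] := char_action_exists gradR (fun g => chi g / chi0 g).
have psiP : multiplicative_char (fun g => chi g / chi0 g).
  split=> [|x y]; first by rewrite (mchar1 chiP) (mchar1 chi0P) divr1.
  by rewrite (mcharM chiP) (mcharM chi0P) invfM mulrACA.
have phi_psi x : phi x = psi (phi0 x).
  move: x; apply: (homogeneous_ind gradR compatR) => [|x y IHx IHy|g i x xR _].
  - by rewrite !linear0.
  - by rewrite !linearD /= IHx IHy.
  rewrite (phi0E _ _ xR) linearZ /= (psiE _ _ xR) (phiE _ _ xR) scalerA.
  by rewrite mulrC divfK // (mchar_neq0 chi0P).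
move=> x; rewrite !phi_psi (feven _ _ psiP _ psiE) ?fphi0 //.
by rewrite chih chi0h divff // oppr_eq0 oner_eq0.
Qed.

End CharacterSeparation.

(** * Existence of dag *)

Lemma linear_lfun (F : fieldType) (V W : vectType F) (f : V -> W) :
  linear f -> exists g : 'Hom(V, W), g =1 f.
Proof.
move=> lf; pose hf := GRing.isLinear.Build F _ _ _ f lf.
pose g : {linear V -> W} := HB.pack f hf.
by exists (linfun g) => x; rewrite lfunE.
Qed.

Lemma closed_field_i (F : closedFieldType) : exists i : F, i ^+ 2 = -1.
Proof.
have [i] := @solve_monicpoly F 2 (nth 0 [:: -1]) isT.
by rewrite !big_ord_recl big_ord0 /= expr0 mulr1 mul0r !addr0 => <-; exists i.
Qed.

Lemma mxs_one_even (F : fieldType) n m : (1%:M :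
  mxs F n m) \in sa_part (mxs F n m) false.
Proof.
by rewrite mem_mxs_part scalar_mx_block block_mxKur block_mxKdl !eqxx.
Qed.

Section MatrixExchange.
Variables (F : closedFieldType) (G : finGroupType) (n m : nat).
Local Notation A := (mxs F n m).
Local Notation M := 'M[F]_(n + m).
Local Notation pr a b := ((a, b) : dsum A (sop A)).
Local Notation one := (1%:M : A).
Variable R : G -> {vspace dsum A (sop A)}.
Hypotheses (gradR : is_grading R) (compatR : grading_compatible (exchange A) R).
Hypotheses (abG : abelian [set: G]) (G0 : #|[set: G]|%:R != 0 :> F).

Lemma exchange_one : pr one one \in R 1%g.
Proof.
apply: (grading_one gradR) => -[x y].
  rewrite -[LHS]/(pr (one *m x) (sop_mul one y)) mul1mx.
  by rewrite sop_mul_evenl ?mxs_one_even //= mulmx1.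
rewrite -[LHS]/(pr ((x : M) *m one) (@sop_mul F A y one)) mulmx1.
by rewrite sop_mul_evenr ?mxs_one_even //= mul1mx.
Qed.

Section Dagger.
Variables (h : G) (chi : G -> F) (phi : 'End(A)).
Hypotheses (two_neq0 : 2%:R != 0 :> F) (h2 : (h ^+ 2 = 1)%g).
Hypothesis twist : forall g a b, pr a b \in R g -> pr a (- b) \in R (g * h)%g.
Hypotheses (chiP : multiplicative_char chi) (chih : chi h = -1).
Hypothesis phiE : char_action R chi phi.

Let phiP : superantiautomorphism phi.
Proof. exact: odd_action_superanti phiE chih. Qed.

(** With W = Q^-2 P, the map dag^2 is x |-> W x W up to the parity sign, and W^2 = 1, so dag^4 =
    1. *)
Lemma exchange_dagger : exists2 dag : 'End(A),
    superantiautomorphism dag /\ (forall x, dag (dag (dag (dag x))) = x) &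
    forall g a b, pr a b \in R g -> pr (dag a) (dag b) \in R g.
Proof.
have [j j2] := closed_field_i F.
have phi_part i x : x \in sa_part A i -> phi x \in sa_part A i.
  exact: char_action_part phiE.
have phi_mul_evenl (x y : M) : (x : A) \in sa_part A false ->
    phi (x *m y) = (phi y : M) *m (phi x : M).
  by move=> x0; rewrite (superanti_mul phiP x y) sop_mul_evenl // phi_part.
have phi_mul_evenr (x y : M) : (y : A) \in sa_part A false ->
    phi (x *m y) = (phi y : M) *m (phi x : M).
  by move=> y0; rewrite (superanti_mul phiP x y) sop_mul_evenr // phi_part.
have [phi' phi'E phi'M] := superanti_untwist phiP j2.
have phi'_part i x : x \in sa_part A i -> phi' x \in sa_part A i.
  by move=> xi; rewrite (phi'E i) // memvZ ?phi_part.
have phi1 : phi one = one.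
  by rewrite (phiE exchange_one) (mchar1 chiP) scale1r.
have phi'1 : phi' one = one.
  by rewrite (phi'E false) ?mxs_one_even // phi1 scale1r.
(* On an element of parity i and degree g, phi'^2 is multiplication by (j^i chi(g))^2; the factor 2
   in the exponent absorbs the sign j^2 = -1. *)
have phi'2k x : iter (2 * #|[set: G]|) (phi' \o phi') x = x.
  rewrite -[RHS](@eigen_iter _ _ _ _ gradR compatR (phi' \o phi')%VF (2 *
    #|[set: G]|)).
    by apply: eq_iter => y /=; rewrite comp_lfunE.
  move=> g i y yR yi; exists (j ^+ i * chi g * (j ^+ i * chi g)).
    have j4 : (j ^+ i) ^+ 4 = 1.
      by rewrite exprAC -[4%N]/(2 * 2)%N exprM j2 sqrrN !expr1n.
    rewrite -expr2 -exprM mulnA exprMn exprM j4 expr1n mul1r.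
    by rewrite mulnC exprM (mchar_expn chiP) expr1n.
  rewrite comp_lfunE (phi'E i _ yi) (phiE yR) scalerA linearZ /= (phi'E i _ yi).
  by rewrite (phiE yR) !scalerA !mulrA.
have [||P [Q [[Pu PE] QP Q4 phiQ fixPQ]]] := @antiautomorphism_root F (n + m)
  (2 * #|[set: G]|) (phi' : M -> M) _ _ phi'M phi'1 phi'2k.
- by rewrite natrM mulf_neq0.
- exact: linearP.
have even_of_fix (X : A) : sa_proj A false X - sa_proj A true X = X ->
    X \in sa_part A false.
  move=> X01; suff X1 : sa_proj A true X = 0.
    by rewrite -(sa_projD X) X1 addr0 sa_proj_mem.
  have /addrI E : sa_proj A false X + sa_proj A true X
      = sa_proj A false X + - sa_proj A true X by rewrite sa_projD X01.
  have /eqP : sa_proj A true X *+ 2 = 0 by rewrite mulr2n {2}E subrr.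
  by rewrite -scaler_nat scaler_eq0 (negPf two_neq0) => /eqP.
have [sigma sigmaE] : exists sigma : 'End(A),
    forall X, sigma X = sa_proj A false X - sa_proj A true X.
  by exists (sa_proj A false - sa_proj A true)%VF => X;
    rewrite add_lfunE opp_lfunE.
have sigma_part i X : X \in sa_part A i -> sigma X = (-1) ^+ i *: X.
  move=> Xi; rewrite sigmaE !(sa_proj_hom _ Xi).
  by case: (i); rewrite ?sub0r ?subr0 ?scaleN1r ?scale1r.
have sigmaM (X Y : A) : sigma (sa_mul X Y) = sa_mul (sigma X) (sigma Y).
  exact: parity_mul sigma_part X Y.
(* The parity automorphism [sigma] commutes with phi', so it fixes P and Q; as 2 is invertible, both
   are even. *)
have [P0 Q0] : (P : A) \in sa_part A false /\ (Q : A) \in sa_part A false.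
  have [| | | |sP sQ] := fixPQ (sigma : M -> M).
  - exact: linearP.
  - exact: sigmaM.
  - by rewrite (sigma_part false) ?mxs_one_even // scale1r.
  - by move=> X; rewrite !sigmaE linearB /= !(part_preserving_proj phi'_part).
  by split; apply: even_of_fix; rewrite -sigmaE.
(* On the even part phi and phi' agree, so [phi Q] is the inverse of Q. *)
have phiQ1 : (phi Q : M) *m Q = 1%:M by rewrite -phiQ (phi'E false) // scale1r.
pose Qi : M := phi Q.
have Qi0 : (Qi : A) \in sa_part A false by apply: phi_part.
have QQi : Q *m Qi = 1%:M by apply: mulmx1C.
have phiQi : phi Qi = Q.
  have := phi_mul_evenl Q Qi Q0;
    rewrite QQi phi1 => /(congr1 (fun X : M => X *m Q)).
  by rewrite -mulmxA -/Qi phiQ1 mulmx1 mul1mx.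
have [dag dagE] : exists dag : 'End(A), forall x, dag x = Qi *m (phi x :
  M) *m Q.
  apply: linear_lfun => a x y.
  by rewrite linearP mulmxDr mulmxDl -scalemxAr -scalemxAl.
have dag_part i x : x \in sa_part A i -> dag x \in sa_part A i.
  move=> xi; rewrite dagE -[i]addbF; apply: sa_part_mul Q0.
  exact: sa_part_mul Qi0 (phi_part _ _ xi).
have phi_dag x : phi (dag x) = Qi *m (phi (phi x) : M) *m Q.
  by rewrite dagE phi_mul_evenr // phi_mul_evenl // phiQi mulmxA.
have [W WE] : exists W : M, W = Qi *m Qi *m P by exists (Qi *m Qi *m P).
have PQi : P *m Qi = Qi *m P.
  by rewrite -[LHS]mul1mx -{1}phiQ1 -!mulmxA [Q *m _]mulmxA QP -mulmxA QQi
    mulmx1.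
(* P commutes with Q^-1, so W^2 = Q^-4 P^2, which is 1 because Q^4 = P^2. *)
have WW : W *m W = 1%:M.
  have -> : W *m W = Qi *m Qi *m (Qi *m Qi) *m (P *m P).
    rewrite WE !mulmxA; congr (_ *m _); rewrite -!mulmxA; do 2!congr (_ *m _).
    by rewrite mulmxA PQi -mulmxA PQi mulmxA.
  rewrite -Q4 -!mulmxA [Qi *m (Q *m _)]mulmxA phiQ1 mul1mx.
  by rewrite [Qi *m (Q *m _)]mulmxA phiQ1 mul1mx [Qi *m (Q *m _)]mulmxA phiQ1
    mul1mx.
have dag2 i x : x \in sa_part A i ->
    dag (dag x) = (-1) ^+ i *: (W *m (x : M) *m W).
  move=> xi; have pp : phi' (phi' x) = (-1) ^+ i *: phi (phi x).
    rewrite (phi'E i _ xi) linearZ /= (phi'E i _ (phi_part _ _ xi)) scalerA.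
    by rewrite -exprMn -expr2 j2.
  have PW : P *m W = Q *m Q.
    rewrite -[LHS]mul1mx -QQi -[Qi in LHS]mul1mx -QQi -!mulmxA.
    by rewrite (mulmxA Qi Qi) (mulmxA _ P) -WE WW mulmx1.
  have -> : W *m (x : M) *m W = Qi *m Qi *m (P *m (x : M)) *m W.
    by rewrite {1}WE !mulmxA.
  rewrite -PE pp -!scalemxAl -!scalemxAr -!scalemxAl scalerA -signr_addb addbb
    scale1r.
  by rewrite -!mulmxA PW dagE phi_dag !mulmxA.
have dag4 x : dag (dag (dag (dag x))) = x.
  have hom i y : y \in sa_part A i -> dag (dag (dag (dag y))) = y.
    move=> yi; rewrite (dag2 i) ?dag_part // (dag2 i) // -!scalemxAr
      -!scalemxAl.
    rewrite scalerA -signr_addb addbb scale1r !mulmxA WW mul1mx.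
    by rewrite -mulmxA WW mulmx1.
  by rewrite -(sa_projD x) !linearD /= !(hom _ _ (sa_proj_mem _ _)).
exists dag.
  split=> //; split=> //.
    by exists (fun x => dag (dag (dag x))) => x; rewrite dag4.
  move=> i k x y xi yk; have [_ _ phiM] := phiP.
  rewrite !dagE (phiM _ _ _ _ xi yk) -scalemxAr -scalemxAl; congr (_ *: _).
  by rewrite /= !mulmxA -(mulmxA _ Q Qi) QQi mulmx1.
(* It remains to see that dag commutes with phi and with the action of each character equal to 1 at
   h. Such an action is an automorphism commuting with phi', so it fixes Q. *)
apply: (odd_even_comm_preserves gradR compatR abG G0 two_neq0 h2 twist chiP
  chih phiE).
  by move=> x; rewrite phi_dag dagE.
move=> psi f psiP psih fE x.
have fM (y z : M) : f (y *m z) = (f y : M) *m (f z : M).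
  exact: (even_action_mul gradR compatR two_neq0 twist psiP fE _ _ psih).
have f1 : f one = one by rewrite (fE _ _ exchange_one) (mchar1 psiP) scale1r.
have f_part i y : y \in sa_part A i -> f y \in sa_part A i.
  exact: char_action_part fE.
have fphi := char_action_comm gradR compatR fE phiE.
have [| | | |fP fQ] := fixPQ (f : M -> M).
- exact: linearP.
- exact: fM.
- exact: f1.
- move=> X; rewrite -(sa_projD (X : A)) !linearD /=.
  rewrite !(phi'E _ _ (sa_proj_mem _ _)) !(phi'E _ _ (f_part _ _ (sa_proj_mem _
    _))).
  by rewrite !linearZ /= !fphi.
have fQi : f Qi = Qi by rewrite fphi fQ.
by rewrite !dagE !fM fQ fQi fphi.
Qed.
End Dagger.
End MatrixExchange.

(** * The center of R *)

Section TypeI.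
Variables (F : fieldType) (G : finGroupType) (A : superAlgebra F).
Local Notation pr a b := ((a, b) : dsum A (sop A)).
Variable R : G -> {vspace dsum A (sop A)}.
Hypotheses (gradR : is_grading R) (compatR : grading_compatible (exchange A) R).

(** The grading is A_g = {x | (x, 0) in R_g}. For (a, b) in R_g, the exchange gives (b, a) in R_g,
    so the hypothesis puts both a and b in A_g. *)
Lemma type_I_of_split :
  (forall g (a b : A), pr a b \in R g -> pr a 0 \in R g) -> type_I R.
Proof.
move=> split0; have [full direct _ _] := gradR.
have [pi [piR pi_sum _]] := directv_sum_projections full direct.
exists (fun g => (linfun (pair_fun 0) @^-1: R g)%VS).
have memG g x : (x \in (linfun (pair_fun (0 : 'End(A))) @^-1:
  R g)%VS) = (pr x 0 \in R g).
  by rewrite -memv_preim lfunE /= /pair_fun zero_lfunE.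
split=> [|g]; last first.
  apply/vspaceP => -[a b]; rewrite mem_prodv /= !memG; apply/idP/andP.
    by move=> ab; split; [apply: split0 ab | apply:
      split0 (exchange_grading_swap compatR ab)].
  case=> a0 /(exchange_grading_swap compatR) b0.
  by have := exchange_gradingD a0 b0; rewrite addr0 add0r.
split=> [||g|g k x y].
- apply/eqP; rewrite eqEsubv subvf; apply/subvP => x _.
  have -> : x = \sum_g (pi g (pr x 0)).1.
    rewrite -[LHS]/(pr x 0).1 -[in LHS](pi_sum (pr x 0)).
    by elim/big_rec2: _ => // g y p _ <-.
  apply/memv_sumr => g _; rewrite memG.
  apply: (split0 _ _ (pi g (pr x 0)).2).
  by rewrite -surjective_pairing.
- apply/directv_sum_independent => u us u0 g _.
  have /directv_sum_independent/(_ (fun k => pr (u k) 0)) indep := direct.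
  suff : pr (u g) 0 = 0 by case.
  apply: (indep _ _ g isT) => [k _|]; first by rewrite -memG us.
  suff -> : \sum_k pr (u k) 0 = pr (\sum_k u k) 0 by rewrite u0.
  by elim/big_rec2: _ => // k y p _ ->; congr pair; rewrite addr0.
- apply/Z2_gradedP => i x; rewrite !memG => xR.
  by have := exchange_grading_proj gradR i xR; rewrite linear0.
- rewrite !memG => xR yR; have := exchange_grading_mul gradR xR yR.
  by rewrite sop_mul0r.
Qed.

End TypeI.

Section MatrixExchange.
Variables (F : closedFieldType) (G : finGroupType) (n m : nat).
Local Notation A := (mxs F n m).
Local Notation M := 'M[F]_(n + m).
Local Notation pr a b := ((a, b) : dsum A (sop A)).
Local Notation one := (1%:M : A).
Variable R : G -> {vspace dsum A (sop A)}.
Hypotheses (gradR : is_grading R) (compatR : grading_compatible (exchange A) R).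
Hypotheses (abG : abelian [set: G]).

Let disjointR g k p : p \in R g -> p \in R k -> g != k -> p = 0.
Proof.
move=> pg pk gk; have [full direct _ _] := gradR.
have [pi [_ _ pi_id]] := directv_sum_projections full direct.
have := pi_id _ g _ pk; rewrite (pi_id _ g _ pg) eqxx (negPf gk).
by [].
Qed.

Let mul_left (a b c d : A) :
  sa_mul (pr a b) (pr c d) = pr (sa_mul a c) (sop_mul b d).
Proof. by []. Qed.

(* The homogeneous components of the central idempotent (1, 0) are central,   *)
(* hence pairs of scalars; those of degree g <> 1 are multiples of (1, -1),   *)
(* because exchange maps (a, b) to (b, a) and (1, 1) has degree 1.            *)
Lemma central_idempotent_components : exists2 e : G -> F,
    forall g, g != 1%g -> e g *: pr one (- one) \in R g &
    pr one 0 - \sum_(g | g != 1%g) e g *: pr one (- one) \in R 1%g.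
Proof.
have [full direct RZ _] := gradR.
have [pi [piR pi_sum pi_id]] := directv_sum_projections full direct.
have one0 := mxs_one_even F n m.
have wC p : sa_mul (pr one 0) p = sa_mul p (pr one 0).
  case: p => x y; rewrite !mul_left sop_mul0r sop_mulr0; congr pair.
  by rewrite /= mul1mx mulmx1.
have comp g : exists a b : F, pi g (pr one 0) = pr (a *: one) (b *: one).
  have := central_component abG gradR piR pi_sum pi_id wC g.
  have : pi g (pr one 0) \in sa_part (dsum A (sop A)) false.
    have wE : sa_proj (dsum A (sop A)) false (pr one 0) = pr one 0.
      by apply: sa_proj_id; rewrite mem_prodv one0 mem0v.
    suff -> : pi g (pr one 0) =
      sa_proj (dsum A (sop A)) false (pi g (pr one 0)).
      exact: sa_proj_mem.
    rewrite -{1}wE -{1}(pi_sum (pr one 0)) !linear_sum /= (bigD1 g) //=.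
    rewrite (pi_id _ _ _ ((Z2_gradedP _).1 (RZ g) _ _ (piR g _))) eqxx.
    rewrite big1 ?addr0 // => k /negPf kg.
    by rewrite (pi_id _ _ _ ((Z2_gradedP _).1 (RZ k) _ _ (piR k _))) eq_sym kg.
  case: (pi g (pr one 0)) => a b; rewrite mem_prodv /= => /andP[a0 b0] abC.
  have /is_scalar_mxP[c ->] : is_scalar_mx (a : M).
    by apply: scalar_mx_commute => X; have := abC (pr (X : A) 0); case.
  have /is_scalar_mxP[d ->] : is_scalar_mx (b : M).
    apply: scalar_mx_commute => X; have : @sop_mul F A b X = @sop_mul F A X b.
      have := congr1 (fun p : dsum A (sop A) => (p.2 : A)) (abC (pr 0 (X : A))).
      exact: id.
    by rewrite sop_mul_evenl // sop_mul_evenr // => ->.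
  by exists c, d; rewrite !scalemx1.
have piE g : g != 1%g -> exists a : F, pi g (pr one 0) = a *: pr one (- one).
  move=> g1; have [a [b E]] := comp g; exists a.
  have ab := piR g (pr one 0); rewrite E in ab.
  (* Adding the exchanged pair gives (a + b)(1, 1), which lies in R_g and in R_1, so it vanishes. *)
  have := exchange_gradingD ab (exchange_grading_swap compatR ab).
  rewrite [b *: _ + _]addrC -!scalerDl => /disjointR/(_ _ g1).
  rewrite (exchange_gradingZ _ (exchange_one gradR)) => /(_ isT)[ab0 _].
  rewrite E; congr pair; rewrite scalerN; apply/eqP.
  by rewrite -addr_eq0 addrC -scalerDl ab0.
have /fin_all_exists[e eE] : forall g, exists a : F,
    g != 1%g -> pi g (pr one 0) = a *: pr one (- one).
  move=> g; case: (eqVneq g 1%g) => [_|g1]; first by exists 0.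
  by have [a ?] := piE g g1; exists a.
exists e => [g g1|]; first by rewrite -eE.
suff -> : pr one 0 - \sum_(g | g != 1%g) e g *:
  pr one (- one) = pi 1%g (pr one 0).
  exact: piR.
rewrite -[X in X - _](pi_sum (pr one 0)) (bigD1 1%g) //=.
rewrite (eq_bigr (fun g => e g *: pr one (- one))) ?addrK //.
Qed.

(** If (1, -1) lies in R_1, every component of (1, 0) of degree other than 1 vanishes. Conversely,
    if all these components vanish, then (1, 0) and (0, 1) lie in R_1, and so does (1, -1);
    otherwise a nonzero one rescales to (1, -1). *)
Lemma exchange_grading_center :
  (pr one (- one) \in R 1%g -> pr one 0 \in R 1%g) /\
  (pr one (- one) \in R 1%g \/ exists2 h, h != 1%g & pr one (- one) \in R h).
Proof.
have [e eR wR] := central_idempotent_components; split=> [z1|].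
  move: wR; rewrite big1 ?subr0 // => g g1.
  by apply: (disjointR (eR g g1) _ g1); apply: memvZ.
case: (boolP [forall (g | g != 1%g), e g == 0]) => [/forall_inP e0|].
  left; rewrite big1 ?subr0 in wR; last by move=> g /e0/eqP->; rewrite scale0r.
  have := exchange_gradingB wR (exchange_grading_swap compatR wR).
  by rewrite subr0 sub0r.
rewrite negb_forall_in => /exists_inP[h h1 eh]; right; exists h => //.
by have := memvZ (e h)^-1 (eR h h1); rewrite scalerA mulVf // scale1r.
Qed.

Lemma exchange_grading_type : #|[set: G]|%:R != 0 :> F ->
  [\/ type_I R, type_II R | type_III R].
Proof.
move=> G0; have [z_split] := exchange_grading_center.
case: (boolP (pr one (- one) \in R 1%g)) => [/z_split wR _|z1 [//|[h h1 zh]]].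
  apply: Or31; apply: type_I_of_split => // g a b ab.
  have := exchange_grading_mul gradR ab wR.
  by rewrite mulg1 sop_mulr0 /= mulmx1.
have twist g (a b : A) : pr a b \in R g -> pr a (- b) \in R (g * h)%g.
  move=> ab; have := exchange_grading_mul gradR ab zh.
  rewrite -scaleN1r sop_mulZr sop_mul_evenr ?mxs_one_even // scaleN1r /=.
  by rewrite mulmx1 mul1mx.
(* The square of (1, -1) is (1, 1), of degree both h^2 and 1. If these differed, the identity matrix
   would be 0 and (1, -1) = 0 would lie in R_1. *)
have h2 : (h ^+ 2 = 1)%g.
  apply/eqP; apply: contraNT z1 => hh1.
  have := twist _ _ _ zh; rewrite opprK -expg2 => hh.
  have [one0] := disjointR hh (exchange_one gradR) hh1.
  by rewrite one0 oppr0 mem0v.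
(* In characteristic 2, (1, -1) = (1, 1) would lie in R_1. *)
have two_neq0 : 2%:R != 0 :> F.
  apply: contraNneq z1 => two0.
  have -> : - one = one.
    apply/eqP; rewrite -subr_eq0 -opprD oppr_eq0 -mulr2n -scaler_nat two0.
    by rewrite scale0r.
  exact: exchange_one.
have oh : #[h]%g = 2%N by apply: nt_prime_order.
have [i i2] := closed_field_i F.
case: (boolP [exists t : G, t ^+ 2 == h]%g) => [/existsP[t /eqP t2]|].
  have [chi chiP chih] := multiplicative_char_involution abG G0 oh.
  have [phi phiE] := char_action_exists gradR chi.
  have [dag [dagP dag4] dagR] :=
    exchange_dagger gradR compatR abG G0 two_neq0 h2 twist chiP chih phiE.
  (* Equality of subspaces is decidable, which makes dag^2 = 1 a boolean test. *)
  case: (eqVneq (plus_space dag) fullv) => [full|nfull].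
    have dd x : dag (dag x) = x by apply/plus_spaceP; rewrite full memvf.
    by apply: Or32; apply:
      (dagger_type_II gradR compatR abG two_neq0 dagP dag4 dagR twist h2 i2
      (or_introl dd) oh dd).
  apply: Or33; apply: (dagger_type_III gradR compatR abG two_neq0 dagP dag4
    dagR twist h2 i2 (or_intror t2)) => //.
    have t4 : (t ^+ 4 = 1)%g by rewrite -[4%N]/(2 * 2)%N expgM t2.
    have : (#[t]%g %| 4)%N by rewrite order_dvdn t4.
    have : ~~ (#[t]%g %| 2)%N by rewrite order_dvdn t2.
    by have := order_gt0 t; case: #[t]%g => [|[|[|[|[|k]]]]] // _ _ /dvdn_leq.
  move=> dd; case/eqP: nfull; apply/vspaceP => x; rewrite memvf.
  exact/plus_spaceP.
rewrite negb_exists => /forallP nsq; apply: Or32.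
have [chi chiP [chih chi2]] := sign_char_nonsquare abG G0 nsq.
have [phi phiE] := char_action_exists gradR chi.
have dd x : phi (phi x) = x := char_action_iter gradR compatR phiE chi2 x.
have phiP := odd_action_superanti gradR compatR two_neq0 twist chiP phiE chih.
(* The value 1 for [t] is a default: the hypothesis relating t to h is met through its alternative
   dag^2 = 1. *)
apply: (@dagger_type_II _ _ _ _ gradR compatR phi h 1%g i abG two_neq0 phiP _ _
  twist h2 i2 (or_introl dd) oh dd).
  by move=> x; rewrite !dd.
apply: (odd_even_comm_preserves gradR compatR abG G0 two_neq0 h2 twist chiP
  chih phiE) => // psi f _ _ fE x.
exact: (char_action_comm gradR compatR phiE fE).
Qed.

End MatrixExchange.

Theorem theorem4 (G : finGroupType) (abG : abelian [set: G])
    (F : closedFieldType)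
    (charF : [pchar F] =i pred0 \/
             exists2 p, p \in [pchar F] & coprime p #|[set: G]|)
    (n m : nat)
    (R : G -> {vspace dsum (mxs F n m) (sop (mxs F n m))})
    (gradR : is_grading R)
    (compatR : grading_compatible (exchange (mxs F n m)) R) :
  [\/ type_I R, type_II R | type_III R].
Proof.
apply: exchange_grading_type => //.
have G_gt0 : (0 < #|[set: G]|)%N by rewrite cardsT; apply/card_gt0P; exists 1%g.
(* If |G| were 0 in F, the characteristic would be a prime divisor of |G|, against either case of
   the assumption on F. *)
apply/negP => G0; case: charF => [char0|[p pchar cop]].
  by have [p] := natf0_pchar G_gt0 G0; rewrite char0.
move: G0; rewrite -(dvdn_pcharf pchar) => pG.
have := pcharf_prime pchar; case: p pchar cop pG => [|[|p]] // _ cop pG _.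
by move: cop; rewrite /coprime (gcdn_idPl pG).
Qed.
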